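(* Let $p\ge 2$ be an even integer such that $m_p<\infty$. For any $\varphi\in L^2(\mathbb{R})$, $$\mathbb{E}|L(\varphi)|^p\le C_p^*\left\{\left(m_2\int_{\mathbb{R}}|\varphi(x)|^2\,dx\right)^{p/2}+m_p\int_{\mathbb{R}}|\varphi(x)|^p\,dx\right\},$$ where $C_p^*=\mathrm{card}(\mathcal{P}_p^* )$. In particular, for any bounded Borel set $A\subset\mathbb{R}$, $$\mathbb{E}|L(A)|^p\le C_p^*\left\{(m_2|A|)^{p/2}+m_p|A|\right\}.$$
   Context: Let $\mathbb{R}_0=\mathbb{R}\setminus\{0\}$ and let $\nu$ be a measure on $\mathbb{R}_0$. For $p\ge 1$ put $m_p=\int_{\mathbb{R}_0}|z|^p\,\nu(dz)$; it is assumed throughout that $m_2<\infty$. Let $N$ be a Poisson random measure on $\mathbb{R}\times\mathbb{R}_0$ with intensity $\mathfrak{m}(dx,dz)=dx\,\nu(dz)$, defined on a complete probability space $(\Omega,\mathcal{F},\mathbb{P})$, and let $\widehat N=N-\mathfrak{m}$ be its compensated version. For $f\in L^2(\mathbb{R}\times\mathbb{R}_0;\mathfrak{m})$, $\int f\,d\widehat N$ denotes the usual $L^2$-isometric stochastic integral with respect to $\widehat N$. For $\varphi\in L^2(\mathbb{R})$ set $$L(\varphi)=\int_{\mathbb{R}}\varphi(x)\,L(dx)=\int_{\mathbb{R}\times\mathbb{R}_0}\varphi(x)z\,\widehat N(dx,dz),$$ and for a bounded Borel set $A\subset\mathbb{R}$ set $L(A)=L(1_A)=\int_{A\times\mathbb{R}_0}z\,\widehat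 N(dx,dz)$; $|A|$ is the Lebesgue measure of $A$. $\mathcal{P}_p^*$ denotes the set of all partitions of $\{1,\dots,p\}$ all of whose blocks $B$ have cardinality $|B|\ge 2$. *)

(* Defs.v *)
From HB Require Import structures.
From mathcomp Require Import all_boot all_order all_algebra.
From mathcomp Require Import all_classical all_reals all_analysis.
From mathcomp Require Import measurable_realfun.
Set Implicit Arguments.
Unset Strict Implicit.
Unset Printing Implicit Defensive.
Import Order.TTheory GRing.Theory Num.Theory.
Import numFieldNormedType.Exports.
Import HBSimple.

Local Open Scope classical_set_scope.
Local Open Scope ring_scope.
Local Open Scope ereal_scope.

Definition card_partitions_ge2 (p : nat) : nat :=
  #|[pred Q : {set {set 'I_p}} |
      finset.partition Q [set: 'I_p]%SET
        && [forall B in Q, (2 <= #|B|)%N]]|.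

Definition nonzero (R : realType) : Type := {x : R | x != 0%R}.

HB.instance Definition _ (R : realType) := Choice.on (nonzero R).
HB.instance Definition _ (R : realType) :=
  isPointed.Build (nonzero R) (exist _ 1%R (oner_neq0 R)).

Definition nonzero_val (R : realType) (z : nonzero R) : R := sval z.

(* The real line without the origin, with the trace of the Borel sigma-algebra
   (that is, the sigma-algebra generated by the inclusion into R). *)
Definition R0 (R : realType) := g_sigma_algebra_preimageType (@nonzero_val R).

Definition moment (R : realType) (nu : {measure set (R0 R) -> \bar R})
    (p : nat) : \bar R :=
  \int[nu]_z (`|nonzero_val z| ^+ p)%:E.

Section poisson_random_measure.
Context d (T : measurableType d) (R : realType) (P : probability T R).
Context d' (S : measurableType d').
Variables (mu : {measure set S -> \bar R}) (N : R.-ker T ~> S).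

(* [poisson_distribution.poisson_pmf] is not used because its value at rate 0
   is the constant 1; the formula below gives the Dirac mass at 0 there. *)
Definition poisson_marginals : Prop :=
  forall A : set S, measurable A ->
    (mu A < +oo -> forall k : nat,
      P [set w | N w A = k%:R%:E] =
        (expR (- fine (mu A)) * fine (mu A) ^+ k / k`!%:R)%:E) /\
    (mu A = +oo -> P [set w | N w A = +oo] = 1).

(* Since each B i may be the full space, the product rule over the whole family
   contains the product rule over every subfamily. *)
Definition independently_scattered : Prop :=
  forall (k : nat) (A : 'I_k -> set S),
    (forall i, measurable (A i)) -> trivIset setT A ->
    forall B : 'I_k -> set (\bar R), (forall i, measurable (B i)) ->
      P (\bigcap_(i in [set: 'I_k]) [set w | B i (N w (A i))]) =
        \prod_(i < k) P [set w | B i (N w (A i))].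

Definition poisson_random_measure : Prop :=
  poisson_marginals /\ independently_scattered.

(* The level set of y = 0 may have infinite measure, but its term is 0; for
   y != 0 the level sets have finite mu-measure in the use made below, so that
   their N-measure is finite P-almost surely. *)
Definition simple_compensated_integral (s : {sfun S >-> R}) (w : T) : R :=
  (\sum_(y \in range s)
    y * fine (N w (s @^-1` [set y]) - mu (s @^-1` [set y])))%R.

(* X is (a version of) the integral of f with respect to N - mu: the limit in
   L^2(P) of the elementary integrals of simple functions supported on sets of
   finite mu-measure which converge to f in L^2(mu). *)
Definition is_compensated_integral (f : S -> R) (X : {RV P >-> R}) : Prop :=
  exists s : nat -> {sfun S >-> R},
    [/\ forall n, mu [set x | s n x != 0%R] < +oo,
        \int[mu]_x ((s n x - f x) ^+ 2)%:E @[n --> \oo] --> 0 &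
        'E_P[fun w => ((simple_compensated_integral (s n) w - X w) ^+ 2)%R]
          @[n --> \oo] --> 0].

End poisson_random_measure.

Definition intensity (R : realType) (nu : {measure set (R0 R) -> \bar R}) :
    {measure set (measurableTypeR R * R0 R) -> \bar R} :=
  lebesgue_measure \x^ nu.

Definition is_levy_integral d (T : measurableType d) (R : realType)
    (P : probability T R) (nu : {measure set (R0 R) -> \bar R})
    (N : R.-ker T ~> (measurableTypeR R * R0 R)%type) (phi : R -> R) (X : {RV P >-> R}) : Prop :=
  is_compensated_integral (intensity nu) N
    (fun u => phi u.1 * nonzero_val u.2)%R X.

(* Main.v *)
Require Import Defs.
From HB Require Import structures.
From mathcomp Require Import all_boot all_order all_algebra.
From mathcomp Require Import all_classical all_reals all_analysis.
From mathcomp Require Import measurable_realfun.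
From mathcomp Require Import ring lra.

(** For a simple function with nonzero values [y_i] on disjoint sets [A_i], the
    integral is [S = sum_i y_i (N(A_i) - l_i)] with independent Poisson counts
    of means [l_i].  The Mecke formula [E[N_i G(N)] = l_i E[G(N + e_i)]] yields
    [E S^(q+1) = sum_j C(q,j+1) k_(j+2) E S^(q-1-j)] with cumulants
    [k_m = sum_i y_i^m l_i], and splitting a partition on the block of a fixed
    point shows that the numbers of partitions without singletons dominate the
    solution of the normalised recursion.  Hence [E S^p <= C_p beta^p] as soon
    as [|k_m| <= beta^m] for [2 <= m <= p]; by weighted AM-GM this only has to
    be assumed for the absolute moments of orders [2] and [p].  Taking
    [beta^p = a^(p/2) + b + e], where [a] and [b] are the second and [p]-th
    moments of the integrand, and letting [e] tend to [0] gives the bound.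
    A general integrand is approximated by simple functions which it dominates
    in absolute value, so that their moments of both orders stay below its own.
*)

Set Implicit Arguments.
Unset Strict Implicit.
Unset Printing Implicit Defensive.
Import Order.TTheory GRing.Theory Num.Theory.
Import numFieldNormedType.Exports.

Local Open Scope ring_scope.

(** * Partitions without singletons *)

Section partitions_without_singletons.
Local Open Scope set_scope.
Context {T : finType}.
Implicit Types (B D : {set T}) (Q : {set {set T}}).

(** Formulated for subsets [D] of a fixed type, so that removing a block in an induction does not
    change the type. *)
Definition partitions_ge2 D : {set {set {set T}}} :=
  [set Q | finset.partition Q D && [forall B in Q, (2 <= #|B|)%N]].

Lemma partitions_ge2U1 D B Q : B \subset D -> (2 <= #|B|)%N ->
  Q \in partitions_ge2 (D :\: B) -> B |: Q \in partitions_ge2 D.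
Proof.
move=> BD B2; rewrite !inE => /andP[partQ /forall_inP Q2]; apply/andP; split.
  rewrite -[X in finset.partition _ X](finset.setID D B) (finset.setIidPr BD).
  apply: partitionU1 => //; first by rewrite -card_gt0; apply: leq_trans B2.
  by rewrite disjoint_sym; apply/finset.setDidPl; rewrite finset.setDDl finset.setUid.
by apply/forall_inP => C; rewrite !inE => /predU1P[->//|/Q2].
Qed.

(** Partitions of [D] are sorted by the block [B] that contains [x]. For each admissible [B], adding
    [B] maps the partitions of [D :\: B] injectively into the fibre over [B]. *)
Lemma card_partitions_ge2_pblock D x : x \in D ->
  (\sum_(B : {set T} | [&& B \subset D, x \in B & (2 <= #|B|)%N])
      #|partitions_ge2 (D :\: B)| <= #|partitions_ge2 D|)%N.
Proof.
move=> xD.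
pose K := [pred B : {set T} | [&& B \subset D, x \in B & (2 <= #|B|)%N]].
rewrite -sum1_card (partition_big (fun Q => finset.pblock Q x) K) /=; last first.
  move=> Q; rewrite inE => /andP[partQ /forall_inP Q2].
  have xQ : x \in finset.cover Q by rewrite (finset.cover_partition partQ).
  have BQ := finset.pblock_mem xQ.
  by rewrite (finset.partitionS partQ BQ) finset.mem_pblock xQ Q2.
apply: leq_sum => B /and3P[BD xB B2].
rewrite sum1_card -(@card_in_imset _ _ (fun Q => B |: Q)
  (mem (partitions_ge2 (D :\: B)))); last first.
  have BN Q : Q \in partitions_ge2 (D :\: B) -> B \notin Q.
    rewrite inE => /andP[partQ _]; apply/negP => BQ.
    by have /fintype.subsetP/(_ x xB) := finset.partitionS partQ BQ; rewrite !inE xB.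
  move=> Q Q' HQ HQ' /= QQ'.
  by rewrite -(finset.setU1K (BN _ HQ)) QQ' (finset.setU1K (BN _ HQ')).
apply/subset_leq_card/fintype.subsetP => _ /imsetP[Q Qp ->].
have Hp := partitions_ge2U1 BD B2 Qp.
rewrite unfold_in /= Hp /=; apply/eqP.
move: Hp; rewrite inE => /andP[/finset.partition_trivIset tr _].
by apply: finset.def_pblock => //; rewrite !inE eqxx.
Qed.

(** The recursion mirrors the choice of the block of a point [x] among [q.+1] points: its [j.+1]
    other elements are chosen among the remaining [q], and [q - j.+1] points are left to partition.
    The proof is a strong induction on the cardinality of [D]. *)
Lemma le_card_partitions_ge2 (R : numDomainType) (p : nat) (r : nat -> R) :
  r 0%N <= 1 ->
  (forall q, (q < p)%N ->
     r q.+1 <= \sum_(j < q) 'C(q, j.+1)%:R * r (q - j.+1)%N) ->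
  forall D, (#|D| <= p)%N -> r #|D| <= #|partitions_ge2 D|%:R.
Proof.
move=> r0 rS D; have [n] := ubnP #|D|.
elim: n D => // n IH D Dn Dp.
have [->|/finset.set0Pn[x xD]] := eqVneq D finset.set0.
  rewrite cards0 (le_trans r0)// ler1n card_gt0; apply/finset.set0Pn; exists finset.set0.
  by rewrite inE partition_set0 eqxx; apply/forall_inP => B; rewrite inE.
have Dq : #|D| = #|D :\ x|.+1 by rewrite (cardsD1 x D) xD.
set q := #|D :\ x| in Dq.
rewrite {1}Dq (le_trans (rS q _)) -?Dq//.
apply: le_trans (_ : (\sum_(B : {set T} | [&& B \subset D, x \in B & (2 <= #|B|)%N])
      #|partitions_ge2 (D :\: B)|)%:R <= _); last first.
  by rewrite ler_nat card_partitions_ge2_pblock.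
rewrite natr_sum.
(* A block of [x] with at least two elements is [x |: E] for a nonempty subset [E] of [D :\ x]. *)
pose K (E : {set T}) := (E \subset D :\ x) && (0 < #|E|)%N.
have xE E : K E -> x \notin E.
  by move=> /andP[ED _]; apply/negP => /(fintype.subsetP ED); rewrite !inE eqxx.
rewrite (reindex_onto (fun E => x |: E) (fun B => B :\ x)) /=; last first.
  by move=> B /and3P[_ xB _]; rewrite finset.setD1K.
rewrite (eq_bigl K); last first.
  move=> E; apply/idP/idP.
    move=> /andP[/and3P[ED _ E2] /eqP EE].
    have xE' : x \notin E by rewrite -EE !inE eqxx.
    rewrite /K; move: E2; rewrite cardsU1 xE' /= add1n ltnS => ->; rewrite andbT.
    by rewrite -EE; apply: finset.setSD.
  move=> KE; have xE' := xE _ KE; move/andP: KE => [ED E0].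
  rewrite cardsU1 xE' add1n ltnS E0 !inE eqxx finset.setU1K // eqxx /= !andbT.
  by rewrite finset.subUset finset.sub1set xD /= (fintype.subset_trans ED) // subD1set.
have le_q E : K E -> (#|E|.-1 < q)%N.
  by move=> /andP[/subset_leq_card Eq E0]; rewrite prednK.
(* The sets [E] are grouped by cardinality [j.+1]. Since [inord] asks for a nonempty ordinal type,
   the index ranges over ['I_q.+1], and the condition [j < q] discards the extra value. *)
pose h (E : {set T}) : 'I_q.+1 := inord #|E|.-1.
rewrite (partition_big h (fun j => (j < q)%N)) /=; last first.
  by move=> E KE; rewrite /h inordK ?le_q// ltnW // ltnS le_q.
rewrite [leRHS]big_mkcond big_ord_recr /= ltnn addr0.
apply: ler_sum => j _; rewrite ltn_ord.
pose KE (E : {set T}) := (E \subset D :\ x) && (#|E| == j.+1).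
rewrite (eq_bigl KE); last first.
  move=> E; rewrite /KE /K -andbA; apply: andb_id2l => /subset_leq_card Eq.
  have [-> | E0] := posnP #|E|; first by [].
  rewrite /= -val_eqE /= inordK ?prednK //; last exact: leq_trans Eq _.
  by rewrite -[in RHS](prednK E0) eqSS.
rewrite mulr_natl -cards_draws -sumr_const.
under [leLHS]eq_bigl do rewrite inE.
apply: ler_sum => E /andP[ED /eqP Ej].
have xE' : x \notin E by apply: xE; rewrite /K ED Ej.
have -> : (q - j.+1)%N = #|D :\: (x |: E)|.
  rewrite cardsD (finset.setIidPr _) ?cardsU1 ?xE' ?add1n ?Ej ?Dq ?subSS//.
  by rewrite finset.subUset finset.sub1set xD (fintype.subset_trans ED)// subD1set.
have le1 : (#|D :\: (x |: E)| < #|D|)%N.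
  apply/proper_card/fintype.properP; split; first exact: subsetDl.
  by exists x => //; rewrite !inE eqxx.
apply: IH; first by rewrite -ltnS (leq_trans _ Dn).
by rewrite (leq_trans _ Dp) // ltnW.
Qed.

End partitions_without_singletons.

Lemma card_partitions_ge2E p :
  card_partitions_ge2 p = #|partitions_ge2 [set: 'I_p]%SET|.
Proof. by apply: eq_card => Q; rewrite !inE. Qed.

Lemma card_partitions_ge2_gt0 p : (2 <= p)%N -> (0 < card_partitions_ge2 p)%N.
Proof.
move=> p2; rewrite card_partitions_ge2E card_gt0; apply/finset.set0Pn.
exists ([set: 'I_p]%SET |: finset.set0)%SET; apply: partitions_ge2U1 => //.
  by rewrite cardsT card_ord.
rewrite finset.setDv inE partition_set0 eqxx.
by apply/forall_inP => B; rewrite inE.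
Qed.

(** * Weighted AM-GM for powers *)

Section weighted_am_gm.
Variable R : realDomainType.
Implicit Type x : R.

(** The left side is the sum of the terms [x ^+ i * (x - 1)] for [i < m], each at most
    [x ^+ n * (x - 1)]: passing from [i] to a larger exponent [n] increases the power if [x >= 1]
    and decreases it if [x <= 1], where the factor [x - 1] is nonpositive. *)
Lemma exprB1_le x m n : 0 <= x -> (m <= n.+1)%N ->
  x ^+ m - 1 <= m%:R * x ^+ n * (x - 1).
Proof.
move=> x0; elim: m => [|m IH mn]; first by rewrite expr0 subrr !mul0r.
have mono : x ^+ m * (x - 1) <= x ^+ n * (x - 1).
  rewrite ltnS in mn; have [x1|x1] := leP 1 x.
    by rewrite ler_wpM2r ?subr_ge0 // ler_weXn2l.
  have x1' := ltW x1; apply: ler_wnM2r; first by rewrite subr_le0.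
    by apply: ler_wiXn2l => //; rewrite x1'.
have := lerD (IH (ltnW mn)) mono.
have -> : x ^+ m - 1 + x ^+ m * (x - 1) = x ^+ m.+1 - 1 by rewrite exprSr; ring.
by move=> /le_trans; apply; rewrite -natr1 le_eqVlt; apply/orP; left; apply/eqP; ring.
Qed.

(** Weighted AM-GM for [n - m] copies of [1] and [m] copies of [x ^+ n]. Induction on [n] avoids
    roots and divisions; [exprB1_le] is exactly the increment from [n] to [n.+1]. *)
Lemma exprn_young x m n : 0 <= x -> (m <= n)%N ->
  n%:R * x ^+ m <= (n - m)%:R + m%:R * x ^+ n.
Proof.
move=> x0; elim: n => [|n IH].
  by rewrite leqn0 => /eqP ->; rewrite subn0 !mul0r addr0.
rewrite leq_eqVlt ltnS => /predU1P[->|mn]; first by rewrite subnn add0r.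
have := lerD (IH mn) (exprB1_le x0 (leqW mn)).
rewrite subSn // -!natr1 => H; rewrite -subr_ge0.
move: H; rewrite -subr_ge0; congr (_ <= _); rewrite exprS; ring.
Qed.

(** This is [exprn_young] for the exponents [q - 2] and [p - 2], multiplied by [x ^+ 2]. *)
Lemma exprn_interpolation x p q : 0 <= x -> (2 <= q <= p)%N ->
  (p - 2)%:R * x ^+ q <= (p - q)%:R * x ^+ 2 + (q - 2)%:R * x ^+ p.
Proof.
move=> x0 /andP[q2 qp].
have := exprn_young x0 (leq_sub2r 2 qp).
move=> /(ler_wpM2r (exprn_ge0 2 x0)).
rewrite mulrDl -!mulrA -!exprD !subnK ?(leq_trans q2)//.
by rewrite subnBA // subnK // (leq_trans q2).
Qed.

End weighted_am_gm.

Local Open Scope classical_set_scope.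
Local Open Scope ring_scope.
Local Open Scope ereal_scope.

(** * Moments of sums of independent Poisson variables *)

Section discrete_random_element.
Context d (T : measurableType d) (R : realType) (C : countType) (V : T -> C).
Hypothesis mV : forall c, measurable (V @^-1` [set c]).

Lemma measurable_preimage_countType (B : set C) : measurable (V @^-1` B).
Proof.
have -> : V @^-1` B = \bigcup_(c in B) (V @^-1` [set c]).
  by apply/seteqP; split => [w Bw|w [c Bc /= ->]] //; exists (V w).
rewrite bigcup_mkcond; apply: countable_bigcupT_measurable => // c.
by case: ifP.
Qed.

Lemma measurable_comp_countType d' (S : measurableType d') (G : C -> S) :
  measurable_fun setT (G \o V).
Proof.
move=> _ B mB; rewrite setTI comp_preimage.
exact: measurable_preimage_countType.
Qed.

(** The space is cut into the fibres of [V], numbered through [pickle], and the integrand is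
    constant on each fibre. A number that is not the code of a value of [V] yields the empty set. *)
Lemma integral_comp_countType (mu : {measure set T -> \bar R}) (G : C -> \bar R) :
  (forall c, 0 <= G c) ->
  \int[mu]_w G (V w) = \esum_(c in [set: C]) (G c * mu (V @^-1` [set c])).
Proof.
move=> G0; pose F m := V @^-1` [set c | pickle c = m].
have mF m : measurable (F m) by exact: measurable_preimage_countType.
have FT : \bigcup_m F m = setT.
  by rewrite -subTset => w _; exists (pickle (V w)).
rewrite -[in LHS]FT ge0_integral_bigcup //; last 2 first.
- by rewrite FT; exact: measurable_comp_countType.
- apply/trivIsetP => i j _ _ ij; apply/seteqP; split => // w /= [ji jj].
  by move: ij; rewrite -ji -jj eqxx.
pose a (m : nat) := if unpickle m is Some c then G c * mu (V @^-1` [set c]) else 0.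
transitivity (\sum_(m <oo | m \in range (@pickle C)) a m).
  rewrite [RHS]eseries_mkcond; apply: eq_eseriesr => m _.
  case: ifPn => [|].
    rewrite inE => -[c _ <-]; rewrite /a pickleK.
    have -> : F (pickle c) = V @^-1` [set c].
      by apply/seteqP; split => w; rewrite /F /=; [exact: (pcan_inj pickleK)|move->].
    rewrite -integral_cst //; apply: eq_integral => w; by rewrite inE /= => ->.
  rewrite notin_setE => nm.
  have -> : F m = set0 by apply/seteqP; split => // w /= Vm; apply: nm; exists (V w).
  by rewrite integral_set0.
rewrite nneseries_esum; last first.
  by move=> m _; rewrite /a; case: unpickle => // c; rewrite mule_ge0.
rewrite (_ : [set m | _] = range (@pickle C)); last first.
  by apply/seteqP; split => m /=; rewrite inE.
rewrite esum_image; last by move=> x y _ _; exact: (pcan_inj pickleK).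
by apply: eq_esum => c _; rewrite /a pickleK.
Qed.

End discrete_random_element.

Section integral_sum_real.
Context d (T : measurableType d) (R : realType) (mu : {measure set T -> \bar R}).

Lemma Rintegral_sum (I : Type) (s : seq I) (h : I -> T -> R) (D : set T) :
  measurable D -> (forall i, mu.-integrable D (EFin \o h i)) ->
  (\int[mu]_(x in D) (\sum_(i <- s) h i x) = \sum_(i <- s) \int[mu]_(x in D) h i x)%R.
Proof.
move=> mD ih; rewrite /Rintegral.
under eq_integral do rewrite -sumEFin.
rewrite (integral_sum mD (fun i => ih i)).
rewrite sum_fine // => i _; apply: integrable_fin_num => //; exact: ih.
Qed.

End integral_sum_real.

Section poisson_vector.
Context (R : realType) (k : nat).
Implicit Types (lam y : 'I_k -> R) (n : {ffun 'I_k -> nat}).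

Definition poisson_weight (l : R) (m : nat) : R := expR (- l) * l ^+ m / m`!%:R.

Lemma poisson_weightS l m :
  (m.+1%:R * poisson_weight l m.+1 = l * poisson_weight l m)%R.
Proof.
rewrite /poisson_weight factS exprS natrM; field.
by rewrite nat1r !pnatr_eq0 -lt0n fact_gt0.
Qed.

Definition poisson_vector_weight lam n : R := (\prod_i poisson_weight (lam i) (n i))%R.

Definition incr_ffun (i : 'I_k) n : {ffun 'I_k -> nat} := [ffun j => (n j + (j == i))%N].

Lemma poisson_vector_weight_incr lam i n :
  ((incr_ffun i n i)%:R * poisson_vector_weight lam (incr_ffun i n) =
   lam i * poisson_vector_weight lam n)%R.
Proof.
rewrite /poisson_vector_weight (bigD1 i) //= [in RHS](bigD1 i) //=.
rewrite mulrA [in RHS]mulrA ffunE eqxx addn1 poisson_weightS; congr (_ * _)%R.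
by apply: eq_bigr => j ji; rewrite ffunE (negbTE ji) addn0.
Qed.

Context d (T : measurableType d) (P : probability T R) (V : T -> {ffun 'I_k -> nat}).
Context (lam : 'I_k -> R) (lam0 : forall i, (0 <= lam i)%R).
Hypothesis mV : forall n, measurable (V @^-1` [set n]).
Hypothesis PV : forall n, P (V @^-1` [set n]) = (poisson_vector_weight lam n)%:E.

Lemma integral_poisson_vector (G : {ffun 'I_k -> nat} -> R) : (forall n, 0 <= G n)%R ->
  \int[P]_w (G (V w))%:E =
    \esum_(n in [set: {ffun 'I_k -> nat}]) (G n * poisson_vector_weight lam n)%:E.
Proof.
move=> G0; rewrite (integral_comp_countType mV P (G := EFin \o G)) //.
by apply: eq_esum => n _; rewrite EFinM -PV.
Qed.

(** Both sides may be infinite here, so that this form of Mecke's formula is available in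
    [W_moment], before any integrability is known. *)
Lemma mecke_ge0 (G : {ffun 'I_k -> nat} -> R) i : (forall n, 0 <= G n)%R ->
  \int[P]_w ((V w i)%:R * G (V w))%:E = (lam i)%:E * \int[P]_w (G (incr_ffun i (V w)))%:E.
Proof.
move=> G0.
rewrite -ge0_integralZl_EFin //; last 2 first.
- by move=> w _; rewrite lee_fin.
- exact: (measurable_comp_countType mV (fun n => (G (incr_ffun i n))%:E)).
rewrite (integral_poisson_vector (G := fun n => (n i)%:R * G n)%R); last first.
  by move=> n; rewrite mulr_ge0.
under [RHS]eq_integral do rewrite -EFinM.
rewrite (integral_poisson_vector (G := fun n => lam i * G (incr_ffun i n))%R); last first.
  by move=> n; rewrite mulr_ge0.
transitivity (\esum_(n in [set n : {ffun 'I_k -> nat} | (0 < n i)%N])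
    ((n i)%:R * G n * poisson_vector_weight lam n)%:E).
  rewrite [RHS]esum_mkcond; apply: eq_esum => n _; case: ifPn => //.
  by rewrite notin_setE /= => /negP; rewrite -eqn0Ngt => /eqP ->; rewrite !mul0r.
(* [n i * weight n] vanishes unless [n = incr_ffun i m], where it is
   [lam i * weight m]. *)
rewrite (reindex_esum setT _ (incr_ffun i)) //; last first.
  split => [n _|n m _ _ nm|n /= n0] /=; first by rewrite ffunE eqxx addn1.
  - by apply/ffunP => j; move/ffunP: nm => /(_ j); rewrite !ffunE => /addIn.
  - exists [ffun j => (n j - (j == i))%N] => //.
    apply/ffunP => j; rewrite !ffunE subnK //.
    by case: eqVneq => // ->.
apply: eq_esum => n _; congr EFin.
by rewrite mulrAC poisson_vector_weight_incr mulrAC.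
Qed.

Variable y : 'I_k -> R.

Definition compensated_sum n : R := (\sum_i y i * ((n i)%:R - lam i))%R.

(* [W] dominates every coordinate and the compensated sum, and increments only
   shift it by constants, so that Mecke's formula bounds its moments. *)
Let b i := (1 + `|y i|)%R.
Let W n : R := (1 + \sum_i b i * ((n i)%:R + lam i))%R.

Let b1 i : (1 <= b i)%R. Proof. by rewrite lerDl. Qed.
Let b0 i : (0 <= b i)%R. Proof. exact: le_trans (b1 i). Qed.

Let W1 n : (1 <= W n)%R.
Proof. by rewrite lerDl sumr_ge0 // => i _; rewrite mulr_ge0 ?addr_ge0 // lam0. Qed.

Let W0 n : (0 <= W n)%R. Proof. exact: le_trans (W1 n). Qed.

Let sum_indic (f : 'I_k -> R) i : (\sum_j f j * (j == i)%:R = f i)%R.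
Proof.
rewrite (bigD1 i) //= eqxx mulr1 big1 ?addr0 // => j ji.
by rewrite (negbTE ji) mulr0.
Qed.

Let W_incr i n : W (incr_ffun i n) = (W n + b i)%R.
Proof.
rewrite /W -addrA; congr (_ + _)%R; rewrite -[X in (_ + X)%R](sum_indic b) -big_split /=.
by apply: eq_bigr => j _; rewrite ffunE natrD; ring.
Qed.

Let compensated_sum_incr i n : compensated_sum (incr_ffun i n) = (compensated_sum n + y i)%R.
Proof.
rewrite /compensated_sum -[X in (_ + X)%R](sum_indic y) -big_split /=.
by apply: eq_bigr => j _; rewrite ffunE natrD; ring.
Qed.

Let W_ge i n : ((n i)%:R <= W n)%R.
Proof.
rewrite /W (bigD1 i) //= addrCA -[leLHS]addr0 lerD //.
  by rewrite -[leLHS]mul1r ler_pM // ?b1 // lerDl.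
by rewrite addr_ge0 // sumr_ge0 // => j _; rewrite mulr_ge0 ?addr_ge0.
Qed.

Let compensated_sum_le n : (`|compensated_sum n| <= W n)%R.
Proof.
apply: (le_trans (ler_norm_sum _ _ _)).
rewrite /W -[leLHS]add0r lerD // ler_sum // => i _.
rewrite normrM ler_pM // ?lerDr //.
by rewrite (le_trans (ler_normB _ _))// !ger0_norm.
Qed.

Let W_incr_le i n q : (W (incr_ffun i n) ^+ q <= (1 + b i) ^+ q * W n ^+ q)%R.
Proof.
rewrite -exprMn lerXn2r ?nnegrE //; first by rewrite mulr_ge0 // addr_ge0.
by rewrite W_incr mulrDl mul1r lerD // ler_peMr // W1.
Qed.

Let mG (G : {ffun 'I_k -> nat} -> R) : measurable_fun setT (fun w => (G (V w))%:E).
Proof. exact: (measurable_comp_countType mV (EFin \o G)). Qed.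

(** By induction on [q]: one factor [W] is expanded into coordinates, Mecke's formula trades each
    coordinate for an increment of the argument of [W ^+ q], and by [W_incr_le] an increment costs
    only a constant factor. *)
Let W_moment q : \int[P]_w (W (V w) ^+ q)%:E < +oo.
Proof.
elim: q => [|q IH].
  under eq_integral do rewrite expr0.
  by rewrite integral_cst //= probability_setT mule1 ltry.
have Wq0 n : (0 <= W n ^+ q)%R by rewrite exprn_ge0.
(* The deterministic part of [W]: what remains is the sum of the [b i * (n i)%:R]. *)
pose c := (1 + \sum_i b i * lam i)%R.
have c0 : (0 <= c)%R by rewrite addr_ge0 // sumr_ge0 // => i _; rewrite mulr_ge0.
have -> : \int[P]_w (W (V w) ^+ q.+1)%:E = \int[P]_w ((c * W (V w) ^+ q)%:E +
     \sum_(i < k) ((b i)%:E * ((V w i)%:R * W (V w) ^+ q)%:E)).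
  apply: eq_integral => w _.
  under eq_bigr do rewrite -EFinM.
  rewrite sumEFin -EFinD; congr EFin.
  under eq_bigr do rewrite mulrA.
  rewrite -mulr_suml -mulrDl exprS; congr (_ * _)%R.
  rewrite /W /c -addrA -big_split /=; congr (_ + _)%R.
  by apply: eq_bigr => i _; rewrite mulrDr addrC.
rewrite ge0_integralD //=; last 4 first.
- by move=> w _; rewrite lee_fin mulr_ge0.
- exact: (mG (fun n => (c * W n ^+ q)%R)).
- by move=> w _; apply: sume_ge0 => i _; rewrite -EFinM lee_fin !mulr_ge0.
- apply: emeasurable_sum => i; apply: measurable_funeM.
  exact: (mG (fun n => ((n i)%:R * W n ^+ q)%R)).
under eq_integral do rewrite EFinM.
rewrite ge0_integralZl_EFin //; last 2 first.
- by move=> w _; rewrite lee_fin.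
- exact: (mG (fun n => (W n ^+ q)%R)).
rewrite lte_add_pinfty //; first by rewrite lte_mul_pinfty // ?lee_fin.
rewrite ge0_integral_sum //; last 2 first.
- move=> i; apply: measurable_funeM.
  exact: (mG (fun n => ((n i)%:R * W n ^+ q)%R)).
- by move=> i w _; rewrite -EFinM lee_fin !mulr_ge0.
apply/lte_sum_pinfty => i _.
rewrite ge0_integralZl_EFin //; last 2 first.
- by move=> w _; rewrite lee_fin mulr_ge0.
- exact: (mG (fun n => ((n i)%:R * W n ^+ q)%R)).
rewrite lte_mul_pinfty // ?lee_fin //.
rewrite (mecke_ge0 (G := fun n => W n ^+ q)%R) //.
rewrite lte_mul_pinfty // ?lee_fin //.
apply: (@le_lt_trans _ _
    (\int[P]_w (((1 + b i) ^+ q)%:E * (W (V w) ^+ q)%:E))).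
  apply: ge0_le_integral => //.
  - by move=> w _; rewrite lee_fin exprn_ge0.
  - exact: (mG (fun n => W (incr_ffun i n) ^+ q)%R).
  - by apply: measurable_funeM; exact: (mG (fun n => W n ^+ q)%R).
  - by move=> w _; rewrite -EFinM lee_fin W_incr_le.
rewrite ge0_integralZl_EFin //; last 3 first.
- by move=> w _; rewrite lee_fin.
- exact: (mG (fun n => W n ^+ q)%R).
- by rewrite exprn_ge0 // addr_ge0.
by rewrite lte_mul_pinfty // lee_fin exprn_ge0 // addr_ge0.
Qed.

Let integrable_W (G : {ffun 'I_k -> nat} -> R) c q :
  (forall n, `|G n| <= c * W n ^+ q)%R -> P.-integrable setT (fun w => (G (V w))%:E).
Proof.
move=> GW; apply: (@le_integrable _ _ _ _ _ _ _ (fun w => c%:E * (W (V w) ^+ q)%:E)) => //.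
- move=> w _; rewrite /= lee_fin (le_trans (GW _)) //.
  by rewrite ler_norm.
- apply: integrableZl => //; apply/integrableP; split; first exact: (mG (fun n => W n ^+ q)%R).
  under eq_integral do rewrite gee0_abs ?lee_fin ?exprn_ge0 //.
  exact: W_moment.
Qed.

Let dominated_incr (G : {ffun 'I_k -> nat} -> R) c q i :
  (forall n, `|G n| <= c * W n ^+ q)%R ->
  (forall n, `|G (incr_ffun i n)| <= (c * (1 + b i) ^+ q) * W n ^+ q)%R.
Proof.
move=> GW n; apply: le_trans (GW _) _; rewrite -mulrA ler_wpM2l //.
(* The constant [c] is nonnegative because [c * W n ^+ q] is nonnegative and [W n] is positive. *)
have := le_trans (normr_ge0 _) (GW n); rewrite pmulr_lge0 // exprn_gt0 //.
exact: lt_le_trans (W1 n).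
Qed.

Let dominated_mul (G : {ffun 'I_k -> nat} -> R) c q i :
  (forall n, `|G n| <= c * W n ^+ q)%R ->
  (forall n, `|(n i)%:R * G n| <= c * W n ^+ q.+1)%R.
Proof.
move=> GW n; rewrite normrM exprS mulrCA ler_pM //.
by rewrite ger0_norm.
Qed.

Let mecke_dominated_ge0 (G : {ffun 'I_k -> nat} -> R) c q i :
  (forall n, 0 <= G n)%R -> (forall n, `|G n| <= c * W n ^+ q)%R ->
  (\int[P]_w ((V w i)%:R * G (V w)) = lam i * \int[P]_w G (incr_ffun i (V w)))%R.
Proof.
move=> G0 GW; rewrite /Rintegral mecke_ge0 // fineM //.
apply: integrable_fin_num => //.
exact: (integrable_W (dominated_incr i GW)).
Qed.

Let mecke (G : {ffun 'I_k -> nat} -> R) c q i :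
  (forall n, `|G n| <= c * W n ^+ q)%R ->
  (\int[P]_w ((V w i)%:R * G (V w)) = lam i * \int[P]_w G (incr_ffun i (V w)))%R.
Proof.
move=> GW.
(* Positive and negative parts inherit the domination by [W], so the nonnegative case applies to
   each and the difference is meaningful. *)
pose Gp n := Num.max (G n) 0%R; pose Gn n := Num.max (- G n)%R 0%R.
have GE n : G n = (Gp n - Gn n)%R.
  rewrite /Gp /Gn; have [n0|/ltW n0] := leP 0%R (G n).
    by rewrite max_r ?oppr_le0 // subr0.
  by rewrite max_l ?oppr_ge0 // sub0r opprK.
have Gp0 n : (0 <= Gp n)%R by rewrite le_max lexx orbT.
have Gn0 n : (0 <= Gn n)%R by rewrite le_max lexx orbT.
have GpW n : (`|Gp n| <= c * W n ^+ q)%R.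
  by rewrite (le_trans _ (GW n)) // ger0_norm // ge_max ler_norm normr_ge0.
have GnW n : (`|Gn n| <= c * W n ^+ q)%R.
  by rewrite (le_trans _ (GW n)) // ger0_norm // ge_max normr_ge0 -normrN ler_norm.
under eq_Rintegral do rewrite GE mulrBr.
rewrite RintegralB //; last 2 first.
- exact: (integrable_W (dominated_mul i GpW)).
- exact: (integrable_W (dominated_mul i GnW)).
rewrite (mecke_dominated_ge0 _ Gp0 GpW) (mecke_dominated_ge0 _ Gn0 GnW) -mulrBr.
rewrite -RintegralB //; last 2 first.
- exact: (integrable_W (dominated_incr i GpW)).
- exact: (integrable_W (dominated_incr i GnW)).
by congr (_ * _)%R; apply: eq_Rintegral => w _; rewrite [in RHS]GE.
Qed.

Let dominated_exp q : (forall n, `|compensated_sum n ^+ q| <= 1 * W n ^+ q)%R.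
Proof. by move=> n; rewrite mul1r normrX lerXn2r ?nnegrE. Qed.

Lemma integrable_compensated_sum q :
  P.-integrable setT (fun w => (compensated_sum (V w) ^+ q)%:E).
Proof. exact: (integrable_W (@dominated_exp q)). Qed.

Definition compensated_moment q : R := (\int[P]_w (compensated_sum (V w) ^+ q))%R.

(** For [m >= 2] this is the cumulant of order [m] of the compensated sum; its first cumulant is 0,
    because of the centring, and is not given by this formula. *)
Definition cumulant m : R := (\sum_i y i ^+ m * lam i)%R.

Lemma compensated_moment0 : compensated_moment 0 = 1%R.
Proof.
rewrite /compensated_moment /Rintegral.
under eq_integral do rewrite expr0.
by rewrite integral_cst //= probability_setT mule1.
Qed.

(** One factor of the power is expanded as a sum over [i], and Mecke's formula replaces each count
    [V w i] by [lam i] together with a shift of the remaining factor by [y i]. The compensator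
    cancels the leading term of the binomial expansion of the shifted power, so the sum starts at
    [j.+1]; the factor [y i] from the expanded term raises the order of the cumulant to [j.+2]. *)
Lemma compensated_momentS q : compensated_moment q.+1 =
  (\sum_(j < q) 'C(q, j.+1)%:R * cumulant j.+2 * compensated_moment (q - j.+1))%R.
Proof.
have -> : compensated_moment q.+1 =
    (\sum_i y i * lam i * (\int[P]_w ((compensated_sum (V w) + y i) ^+ q) -
      compensated_moment q))%R.
  rewrite {1}/compensated_moment.
  transitivity (\int[P]_w (\sum_i (y i * ((V w i)%:R * compensated_sum (V w) ^+ q) -
      y i * lam i * compensated_sum (V w) ^+ q)))%R.
    apply: eq_Rintegral => w _; rewrite exprS {1}/compensated_sum mulr_suml.
    by apply: eq_bigr => i _; ring.
  have i1 i : P.-integrable setT (fun w => ((V w i)%:R * compensated_sum (V w) ^+ q)%:E).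
    exact: (integrable_W (dominated_mul i (@dominated_exp q))).
  have i2 i : P.-integrable setT (fun w => (y i * ((V w i)%:R * compensated_sum (V w) ^+ q))%:E).
    under [X in integrable _ _ X]funext do rewrite EFinM.
    exact: integrableZl.
  have i3 (c : R) : P.-integrable setT (fun w => (c * compensated_sum (V w) ^+ q)%:E).
    under [X in integrable _ _ X]funext do rewrite EFinM.
    by apply: integrableZl => //; exact: integrable_compensated_sum.
  rewrite Rintegral_sum //; last first.
    by move=> i; exact: (integrableB measurableT (i2 i) (i3 _)).
  apply: eq_bigr => i _; rewrite (RintegralB measurableT (i2 i) (i3 _)).
  rewrite (RintegralZl _ measurableT (i1 i)).
  rewrite (RintegralZl _ measurableT (integrable_compensated_sum q)).
  rewrite (mecke i (@dominated_exp q)) mulrBr !mulrA; congr (_ * _ - _)%R.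
  by apply: eq_Rintegral => w _; rewrite compensated_sum_incr.
have exp i : (\int[P]_w ((compensated_sum (V w) + y i) ^+ q) - compensated_moment q =
    \sum_(j < q) 'C(q, j.+1)%:R * y i ^+ j.+1 * compensated_moment (q - j.+1))%R.
  have -> : (\int[P]_w ((compensated_sum (V w) + y i) ^+ q) =
      \sum_(j < q.+1) 'C(q, j)%:R * y i ^+ j * compensated_moment (q - j))%R.
    transitivity (\int[P]_w (\sum_(j < q.+1)
        'C(q, j)%:R * y i ^+ j * compensated_sum (V w) ^+ (q - j)))%R.
      apply: eq_Rintegral => w _; rewrite exprDn; apply: eq_bigr => j _.
      by rewrite -mulr_natl; ring.
    rewrite Rintegral_sum //.
      apply: eq_bigr => j _; rewrite RintegralZl //.
      exact: integrable_compensated_sum.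
    move=> j; under [X in integrable _ _ X]funext do rewrite /= EFinM.
    by apply: integrableZl => //; exact: integrable_compensated_sum.
  by rewrite big_ord_recl bin0 expr0 !mul1r subn0 addrAC subrr add0r.
under eq_bigr do rewrite exp mulr_sumr.
rewrite exchange_big /=; apply: eq_bigr => j _.
rewrite /cumulant mulrAC mulr_sumr; apply: eq_bigr => i _.
by rewrite !exprS; ring.
Qed.

Lemma compensated_moment_le (beta : R) p : (0 < beta)%R ->
  (forall m, (2 <= m <= p)%N -> `|cumulant m| <= beta ^+ m)%R ->
  (compensated_moment p <= (card_partitions_ge2 p)%:R * beta ^+ p)%R.
Proof.
move=> beta0 kb.
(* After this normalisation every cumulant in the recursion contributes a factor at most 1, since
   the powers of [beta] match: [q.+1] is the sum of [q - j.+1] and [j.+2]. *)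
pose r q := (`|compensated_moment q| / beta ^+ q)%R.
rewrite -ler_pdivrMr ?exprn_gt0 //.
apply: le_trans (_ : r p <= _)%R.
  by rewrite ler_pM2r ?invr_gt0 ?exprn_gt0 // ler_norm.
rewrite card_partitions_ge2E.
have {1}-> : p = #|[set: 'I_p]%SET| by rewrite cardsT card_ord.
apply: (@le_card_partitions_ge2 _ R p); last by rewrite cardsT card_ord.
  by rewrite /r compensated_moment0 expr0 normr1 divr1.
move=> q qp; rewrite /r ler_pdivrMr ?exprn_gt0 // compensated_momentS.
apply: (le_trans (ler_norm_sum _ _ _)); rewrite mulr_suml; apply: ler_sum => j _.
rewrite !normrM ger0_norm // -!mulrA ler_wpM2l //.
have -> : (beta ^+ q.+1 = beta ^+ (q - j.+1) * beta ^+ j.+2)%R.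
  by rewrite -exprD addnS subnK.
rewrite mulKf ?gt_eqF ?exprn_gt0 // [leLHS]mulrC ler_wpM2l // kb //=.
by rewrite (leq_trans _ qp) // ltnS ltn_ord.
Qed.

End poisson_vector.

(** * Poisson counts and integrals of simple functions *)

Section poisson_random_measure_counts.
Context d (T : measurableType d) (R : realType) (P : probability T R).
Context d' (S : measurableType d').
Context (mu : {measure set S -> \bar R}) (N : R.-ker T ~> S).
Hypothesis hN : poisson_random_measure P mu N.

Lemma poisson_weight_sum (l : R) : (0 <= l)%R ->
  \sum_(n <oo) (poisson_weight l n)%:E = 1.
Proof.
move=> l0; rewrite [RHS](_ : _ = (expR (- l))%:E * (expR l)%:E); last first.
  by rewrite -EFinM expRN mulVf ?gt_eqF ?expR_gt0.
under eq_eseriesr do rewrite /poisson_weight -mulrA EFinM.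
rewrite nneseriesZl /=; last by move=> n _; rewrite lee_fin divr_ge0 // exprn_ge0.
congr *%E; rewrite /expR -EFin_lim; last exact: is_cvg_series_exp_coeff.
by apply/congr_lim/funext => n /=; rewrite /series /= -sumEFin.
Qed.

Let mN A : measurable A -> measurable_fun setT (fun w => N w A).
Proof. by move=> mA; exact: measurable_kernel. Qed.

Lemma measurable_poisson_level A (x : \bar R) : measurable A -> measurable [set w | N w A = x].
Proof.
move=> mA; rewrite -[X in measurable X]setTI.
exact: (mN mA measurableT (emeasurable_set1 x)).
Qed.

Definition non_integer_count A := ~` \bigcup_n [set w | N w A = n%:R%:E].

Lemma measurable_non_integer_count A : measurable A -> measurable (non_integer_count A).
Proof.
move=> mA; apply: measurableC; apply: bigcupT_measurable => n.
exact: measurable_poisson_level.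
Qed.

(** Integrality of the counts is derived from the marginals: the Poisson weights sum to 1, so the
    disjoint events that the count equals [n] exhaust the probability. *)
Lemma non_integer_count0 A : measurable A -> mu A < +oo -> P (non_integer_count A) = 0.
Proof.
move=> mA Aoo; rewrite probability_setC; last first.
  by apply: bigcupT_measurable => n; exact: measurable_poisson_level.
rewrite measure_semi_bigcup; last 3 first.
- by move=> n; exact: measurable_poisson_level.
- apply/trivIsetP => i j _ _ ij; apply/seteqP; split => // w /= [->] [] /eqP.
  by rewrite eqr_nat (negbTE ij).
- by apply: bigcupT_measurable => n; exact: measurable_poisson_level.
rewrite (_ : \sum_(n <oo) _ = 1) ?subee // -(@poisson_weight_sum (fine (mu A))) ?fine_ge0 //.
by apply: eq_eseriesr => n _; exact: (hN.1 A mA).1.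
Qed.

Lemma measurable_truncn_fine (n : nat) : measurable [set x : \bar R | Num.truncn (fine x) = n].
Proof.
(* For [n = 0] the interval is unbounded below, because [Num.truncn] sends negative numbers to 0. *)
have -> : [set x : \bar R | Num.truncn (fine x) = n] = fine @^-1`
    [set` Interval (if n is 0 then BInfty R true else BLeft n%:R) (BLeft n.+1%:R)].
  case: n => [|n]; apply/seteqP; split => x; rewrite /= in_itv /=.
  - by move/truncn0Pn; rewrite -ltNge.
  - by rewrite ltNge => /truncn0Pn.
  - move=> xn; rewrite -xn; apply: truncn_itv.
    by rewrite (le_trans ler01) // -truncn_gt0 xn.
  - exact: truncn_def.
rewrite -[X in measurable X]setTI; apply: fine_measurable => //.
Qed.

(** The truncated count equals [n] wherever the count does, and the converse can fail only on the
    null set [non_integer_count A]. *)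
Lemma poisson_count_law A n : measurable A -> mu A < +oo ->
  P [set w | Num.truncn (fine (N w A)) = n] = (poisson_weight (fine (mu A)) n)%:E.
Proof.
move=> mA Aoo; rewrite -((hN.1 A mA).1 Aoo n).
have mE := measurable_poisson_level n%:R%:E mA.
have mF : measurable [set w | Num.truncn (fine (N w A)) = n].
  by rewrite -[X in measurable X]setTI; exact: (mN mA measurableT (measurable_truncn_fine n)).
apply/eqP; rewrite eq_le; apply/andP; split; last first.
  by apply: le_measure; rewrite ?inE // => w /= ->; rewrite natrK.
have mD := measurable_non_integer_count mA.
rewrite -(measureU0 mE mD (non_integer_count0 mA Aoo)).
apply: le_measure; rewrite ?inE //; first exact: measurableU.
move=> w /= Fn; have [|] := pselect (exists m : nat, N w A = m%:R%:E).
  by move=> [m Nm]; left; rewrite /= Nm -Fn Nm /= natrK.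
by move=> NN; right => -[m _ Nm]; apply: NN; exists m.
Qed.

Context (k : nat) (A : 'I_k -> set S).
Hypothesis mA : forall i, measurable (A i).
Hypothesis Aoo : forall i, mu (A i) < +oo.
Hypothesis tA : trivIset setT A.

(* A count that is not a natural number is replaced by a junk value; this
   happens with probability 0 when [mu (A i)] is finite. *)
Definition poisson_counts w : {ffun 'I_k -> nat} :=
  [ffun i => Num.truncn (fine (N w (A i)))].

Let preimage_counts n : poisson_counts @^-1` [set n] =
  \bigcap_(i in [set: 'I_k]) [set w | Num.truncn (fine (N w (A i))) = n i].
Proof.
apply/seteqP; split => [w /= <- i _ /=|w /= wn]; first by rewrite ffunE.
by apply/ffunP => i; rewrite ffunE wn.
Qed.

Lemma measurable_poisson_counts n : measurable (poisson_counts @^-1` [set n]).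
Proof.
rewrite preimage_counts ; apply: fin_bigcap_measurable => // i _.
rewrite -[X in measurable X]setTI.
exact: (mN (mA i) measurableT (measurable_truncn_fine (n i))).
Qed.

Lemma poisson_counts_law n : P (poisson_counts @^-1` [set n]) =
  (poisson_vector_weight (fun i => fine (mu (A i))) n)%:E.
Proof.
rewrite preimage_counts.
rewrite (hN.2 k A mA tA (fun i => [set x : \bar R | Num.truncn (fine x) = n i])); last first.
  by move=> i; exact: measurable_truncn_fine.
rewrite /poisson_vector_weight -prodEFin; apply: eq_bigr => i _.
exact: poisson_count_law.
Qed.

Lemma poisson_counts_ae : {ae P, forall w i, N w (A i) = (poisson_counts w i)%:R%:E}.
Proof.
apply: filter_forall => i.
exists (non_integer_count (A i)); split.
- exact: measurable_non_integer_count.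
- exact: non_integer_count0.
move=> w /= Nw [m _ /= Nm]; apply: Nw.
by rewrite ffunE Nm /= natrK.
Qed.

End poisson_random_measure_counts.

Section simple_function_levels.
Import HBSimple.
Context d' (S : measurableType d') (R : realType) (s : {sfun S >-> R}).

(** The value 0 is left out, so that all the level sets lie in the support of [s] and have finite
    measure as soon as the support does. *)
Definition nonzero_values : seq R :=
  [seq y <- finmap.enum_fset (fset_set (range s)) | y != 0%R].
Definition level_value (i : 'I_(size nonzero_values)) : R := nonzero_values`_i.
Definition level_set (i : 'I_(size nonzero_values)) : set S := s @^-1` [set level_value i].

Lemma uniq_nonzero_values : uniq nonzero_values.
Proof. by rewrite filter_uniq // finmap.fset_uniq. Qed.

Lemma mem_nonzero_values x : (s x \in nonzero_values) = (s x != 0%R).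
Proof.
rewrite mem_filter in_fset_set //; case: (s x != 0%R) => //=.
by rewrite mem_set //; exists x.
Qed.

Lemma level_value_neq0 i : level_value i != 0%R.
Proof.
by have := mem_nth 0%R (ltn_ord i); rewrite mem_filter => /andP[].
Qed.

Lemma measurable_level_set i : measurable (level_set i).
Proof. exact: measurable_sfunP. Qed.

Lemma trivIset_level_set : trivIset setT level_set.
Proof.
apply/trivIsetP => i j _ _ ij; apply/seteqP; split => // x [].
rewrite /level_set /= => -> /eqP; rewrite /level_value.
by rewrite nth_uniq ?uniq_nonzero_values // (inj_eq val_inj) (negbTE ij).
Qed.

Lemma level_set_sub i : level_set i `<=` [set x | s x != 0%R].
Proof. by rewrite /level_set => x /= ->; exact: level_value_neq0. Qed.

Lemma measurable_nonzero_set : measurable [set x | s x != 0%R].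
Proof.
rewrite [X in measurable X](_ : _ = s @^-1` (~` [set 0%R])).
  by apply: measurable_sfunP; exact: measurableC.
by apply/seteqP; split => x /= /eqP.
Qed.

Lemma sum_level (V : nmodType) (F : R -> V) :
  (\sum_i F (level_value i) = \sum_(y <- nonzero_values) F y)%R.
Proof. by rewrite (big_nth 0%R) big_mkord. Qed.

Lemma comp_sfun_levels (h : R -> R) x : h 0%R = 0%R ->
  (h (s x) = \sum_i h (level_value i) * \1_(level_set i) x)%R.
Proof.
move=> h0; transitivity (\sum_(y <- nonzero_values) h y * (s x == y)%:R)%R; last first.
  rewrite -(sum_level (fun y => h y * (s x == y)%:R)%R); apply: eq_bigr => i _.
  rewrite indicE; congr (_ * _%:R)%R.
  congr nat_of_bool; by apply/idP/idP; rewrite in_setE /level_set /= => /eqP.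
have [sx0|sx0] := eqVneq (s x) 0%R.
  rewrite sx0 h0 big1_seq // => y /andP[_]; rewrite mem_filter eq_sym => /andP[/negbTE -> _].
  by rewrite mulr0.
rewrite (bigD1_seq (s x)) ?uniq_nonzero_values ?mem_nonzero_values //= eqxx mulr1.
by rewrite big1 ?addr0 // => y /negbTE; rewrite eq_sym => ->; rewrite mulr0.
Qed.

Section measure.
Variable m : {measure set S -> \bar R}.

Lemma integral_comp_sfun (h : R -> R) : h 0%R = 0%R -> (forall y, 0 <= h y)%R ->
  \int[m]_x (h (s x))%:E = \sum_i ((h (level_value i))%:E * m (level_set i)).
Proof.
move=> h0 hge0.
under eq_integral do rewrite comp_sfun_levels // -sumEFin.
rewrite ge0_integral_sum //; last 2 first.
- move=> i; apply/measurable_EFinP; apply: measurable_funM => //.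
  exact: measurable_indic (measurable_level_set i).
- by move=> i x _; rewrite lee_fin mulr_ge0.
apply: eq_bigr => i _; under eq_integral do rewrite EFinM.
rewrite ge0_integralZl_EFin //; last first.
  by apply/measurable_EFinP; exact: measurable_indic (measurable_level_set i).
by rewrite integral_indic ?setIT //; exact: measurable_level_set.
Qed.

Hypothesis moo : m [set x | s x != 0%R] < +oo.

Lemma measure_level_set_lty i : m (level_set i) < +oo.
Proof.
apply: le_lt_trans moo; apply: le_measure; rewrite ?inE.
- exact: measurable_level_set.
- exact: measurable_nonzero_set.
- exact: level_set_sub.
Qed.

Let integrable_indic_level i : m.-integrable setT (fun x => (\1_(level_set i) x)%:E).
Proof.
have mi := measurable_level_set i; apply/integrableP; split.
  by apply/measurable_EFinP; exact: measurable_indic.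
under eq_integral do rewrite gee0_abs ?lee_fin //.
by rewrite integral_indic // setIT measure_level_set_lty.
Qed.

Let integrable_term i :
  m.-integrable setT (fun x => (level_value i * \1_(level_set i) x)%:E).
Proof.
under [X in integrable _ _ X]funext do rewrite EFinM.
exact: integrableZl.
Qed.

Lemma integrable_sfun : m.-integrable setT (EFin \o s).
Proof.
rewrite (_ : EFin \o s = fun x => \sum_i (level_value i * \1_(level_set i) x)%:E).
  by apply: integrable_sum => // i _; exact: integrable_term.
by apply/funext => x /=; rewrite sumEFin -(@comp_sfun_levels id).
Qed.

Lemma Rintegral_sfun : (\int[m]_x s x = \sum_i level_value i * fine (m (level_set i)))%R.
Proof.
under eq_Rintegral do rewrite (@comp_sfun_levels id) //.
rewrite Rintegral_sum //; apply: eq_bigr => i _.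
rewrite (RintegralZl _ measurableT (integrable_indic_level i)).
by rewrite /Rintegral integral_indic ?setIT //; exact: measurable_level_set.
Qed.

End measure.

End simple_function_levels.

Section simple_compensated_integral_theory.
Import HBSimple.
Context d (T : measurableType d) (R : realType) (P : probability T R).
Context d' (S : measurableType d').
Context (mu : {measure set S -> \bar R}) (N : R.-ker T ~> S).

Local Notation I := (simple_compensated_integral mu N).

Lemma simple_compensated_integral_levels (s : {sfun S >-> R}) w :
  I s w = (\sum_i level_value i * fine (N w (level_set i) - mu (@level_set _ _ _ s i))%E)%R.
Proof.
rewrite /simple_compensated_integral.
rewrite (sum_level s (fun y => y * fine (N w (s @^-1` [set y]) - mu (s @^-1` [set y])))%R).
rewrite fsbig_finite // /nonzero_values big_filter [in RHS]big_mkcond /=.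
by apply: eq_bigr => y _; case: eqVneq => //= ->; rewrite mul0r.
Qed.

Lemma measurable_simple_compensated_integral (s : {sfun S >-> R}) :
  measurable_fun setT (I s).
Proof.
rewrite (_ : I s = fun w => (\sum_i level_value i *
    fine (N w (level_set i) - mu (@level_set _ _ _ s i))%E)%R).
  apply: measurable_sum => i; apply: measurable_funM => //.
  apply: measurableT_comp; first exact: fine_measurable.
  apply: emeasurable_funB => //; apply: measurable_kernel; exact: measurable_level_set.
by apply/funext => w; exact: simple_compensated_integral_levels.
Qed.

(** This form no longer refers to level sets, so it gives linearity although the level sets of
    [s - t] differ from those of [s] and [t]. *)
Lemma simple_compensated_integralE (s : {sfun S >-> R}) w :
  mu [set x | s x != 0%R] < +oo -> N w [set x | s x != 0%R] < +oo ->
  I s w = (\int[N w]_x s x - \int[mu]_x s x)%R.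
Proof.
move=> muoo Noo; rewrite simple_compensated_integral_levels !Rintegral_sfun // -sumrB.
apply: eq_bigr => i _; rewrite fineB ?mulrBr // ge0_fin_numE //; exact: measure_level_set_lty.
Qed.

Hypothesis hN : poisson_random_measure P mu N.

Lemma poisson_count_lty_ae A : measurable A -> mu A < +oo -> {ae P, forall w, N w A < +oo}.
Proof.
move=> mA Aoo; exists (non_integer_count N A); split.
- exact: measurable_non_integer_count.
- exact: (non_integer_count0 hN).
by move=> w /= Nw [m _ /= Nm]; apply: Nw; rewrite Nm ltry.
Qed.

Lemma simple_compensated_integralB (s t : {sfun S >-> R}) :
  mu [set x | s x != 0%R] < +oo -> mu [set x | t x != 0%R] < +oo ->
  mu [set x | (s - t)%R x != 0%R] < +oo /\
  {ae P, forall w, I (s - t)%R w = (I s w - I t w)%R}.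
Proof.
move=> soo too.
have st_sub : [set x | (s - t)%R x != 0%R] `<=` [set x | s x != 0%R] `|` [set x | t x != 0%R].
  move=> x /= st; have {}st : (s x - t x != 0)%R by [].
  have [sx|sx] := eqVneq (s x) 0%R; last by left.
  by right; apply: contra st => /eqP ->; rewrite sx subr0.
(* Proved for every measure because it serves both for [mu] and, for almost every [w], for [N w]. *)
have lty (m : {measure set S -> \bar R}) : m [set x | s x != 0%R] < +oo ->
    m [set x | t x != 0%R] < +oo -> m [set x | (s - t)%R x != 0%R] < +oo.
  move=> ms mt; apply: le_lt_trans (lte_add_pinfty ms mt).
  apply: (@le_trans _ _ (m ([set x | s x != 0%R] `|` [set x | t x != 0%R]))).
    apply: le_measure; rewrite ?inE //; first exact: measurable_nonzero_set.
    by apply: measurableU; exact: measurable_nonzero_set.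
  by apply: measureU2; exact: measurable_nonzero_set.
split; first exact: lty.
have := poisson_count_lty_ae (measurable_nonzero_set s) soo.
have := poisson_count_lty_ae (measurable_nonzero_set t) too.
apply: filterS2 => w Nt Ns.
rewrite !simple_compensated_integralE //; try exact: lty.
under eq_Rintegral do rewrite sfunB /=.
under [X in (_ - X)%R = _]eq_Rintegral do rewrite sfunB /=.
rewrite !RintegralB //; try exact: integrable_sfun.
by ring.
Qed.

Section moments.
Variable s : {sfun S >-> R}.
Hypothesis soo : mu [set x | s x != 0%R] < +oo.

Let lam i := fine (mu (@level_set _ _ _ s i)).
Let y := @level_value _ _ _ s.
Let V := poisson_counts N (@level_set _ _ _ s).

Let lam0 i : (0 <= lam i)%R. Proof. exact: fine_ge0. Qed.

Let mV n : measurable (V @^-1` [set n]).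
Proof. by apply: measurable_poisson_counts => i; exact: measurable_level_set. Qed.

Let level_lty i := measure_level_set_lty soo i.

Let PV n : P (V @^-1` [set n]) = (poisson_vector_weight lam n)%:E.
Proof.
apply: poisson_counts_law => //; first by move=> i; exact: measurable_level_set.
exact: trivIset_level_set.
Qed.

Let I_ae : {ae P, forall w, I s w = compensated_sum lam y (V w)}.
Proof.
have := poisson_counts_ae hN (@measurable_level_set _ _ _ s) level_lty.
apply: filterS => w NV; rewrite simple_compensated_integral_levels.
apply: eq_bigr => i _; rewrite NV fineB //= ge0_fin_numE //; exact: level_lty.
Qed.

Lemma simple_compensated_integral_moment p :
  \int[P]_w (I s w ^+ p)%:E = (compensated_moment P V lam y p)%:E.
Proof.
rewrite /compensated_moment /Rintegral fineK; last first.
  by apply: integrable_fin_num => //; exact: (integrable_compensated_sum lam0 mV PV).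
apply: ae_eq_integral => //.
- apply/measurable_EFinP; apply: measurable_funX.
  exact: measurable_simple_compensated_integral.
- exact: measurable_int (integrable_compensated_sum lam0 mV PV y p).
by move: I_ae; apply: filterS => w IE _; rewrite IE.
Qed.

Let power_sumE q : (0 < q)%N ->
  \int[mu]_x (`|s x| ^+ q)%:E = (\sum_i `|y i| ^+ q * lam i)%:E.
Proof.
move=> q0; rewrite (@integral_comp_sfun _ _ _ s mu (fun z => `|z| ^+ q)%R) //; last first.
  by rewrite normr0 expr0n eqn0Ngt q0.
rewrite -sumEFin; apply: eq_bigr => i _; rewrite EFinM fineK //.
by rewrite ge0_fin_numE //; exact: level_lty.
Qed.

(** The moment recursion at [q = 1] has a single term, the second cumulant. *)
Lemma simple_compensated_integral_isometry :
  \int[P]_w (I s w ^+ 2)%:E = \int[mu]_x (s x ^+ 2)%:E.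
Proof.
rewrite simple_compensated_integral_moment (compensated_momentS lam0 mV PV).
under eq_integral do rewrite -real_normK ?num_real //.
rewrite power_sumE // big_ord1 /= subnn (compensated_moment0 P V) mulr1 binn mul1r.
by congr EFin; apply: eq_bigr => i _; rewrite real_normK ?num_real.
Qed.

Lemma simple_compensated_integral_moment_le p (beta : R) :
  (2 <= p)%N -> ~~ odd p -> (0 < beta)%R ->
  \int[mu]_x (`|s x| ^+ 2)%:E <= (beta ^+ 2)%:E ->
  \int[mu]_x (`|s x| ^+ p)%:E <= (beta ^+ p)%:E ->
  \int[P]_w (`|I s w| ^+ p)%:E <= ((card_partitions_ge2 p)%:R * beta ^+ p)%:E.
Proof.
move=> p2 evp beta0; rewrite !power_sumE ?(leq_trans _ p2) // !lee_fin => k2 kp.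
(* Evenness of [p] removes the absolute value, which makes the recursion for plain moments
   applicable. *)
under eq_integral do rewrite -normrX ger0_norm ?exprn_even_ge0 //.
rewrite simple_compensated_integral_moment lee_fin.
apply: (compensated_moment_le lam0 mV PV) => // m /andP[m2 mp].
apply: (@le_trans _ _ (\sum_i `|y i| ^+ m * lam i)%R).
  apply: (le_trans (ler_norm_sum _ _ _)); apply: ler_sum => i _.
  by rewrite normrM normrX (ger0_norm (lam0 i)).
have bn q : (0 < beta ^+ q)%R by rewrite exprn_gt0.
(* The normalised absolute moments. Those of orders 2 and [p] are at most 1 by hypothesis, and
   interpolation term by term carries this bound to every order [m] in between. *)
pose K q := (\sum_i (`|y i| / beta) ^+ q * lam i)%R.
have KE q : K q = ((\sum_i `|y i| ^+ q * lam i) / beta ^+ q)%R.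
  by rewrite mulr_suml; apply: eq_bigr => i _; rewrite expr_div_n mulrAC.
have K2 : (K 2 <= 1)%R by rewrite KE ler_pdivrMr // mul1r.
have Kp : (K p <= 1)%R by rewrite KE ler_pdivrMr // mul1r.
rewrite -[leRHS]mul1r -ler_pdivrMr // -KE.
(* The case [p = 2] is separate because the interpolation inequality carries the factor [p - 2];
   there [m = 2] as well. *)
move: p2; rewrite leq_eqVlt => /predU1P[p2|p2].
  by rewrite (_ : m = 2%N) //; apply/eqP; rewrite eqn_leq m2 andbT p2.
have p20 : (0 < (p - 2)%:R :> R)%R by rewrite ltr0n subn_gt0.
rewrite -(ler_pM2l p20) mulr1 (@le_trans _ _ ((p - m)%:R * K 2 + (m - 2)%:R * K p)%R) //.
  rewrite /K !mulr_sumr -big_split /=; apply: ler_sum => i _.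
  rewrite 3!(mulrA _%:R) -mulrDl ler_wpM2r // exprn_interpolation ?m2 //.
  by rewrite divr_ge0 // ltW.
rewrite (_ : (p - 2)%:R = (p - m)%:R * 1 + (m - 2)%:R * 1 :> R)%R; last first.
  by rewrite !mulr1 -natrD addnBA // subnK.
by rewrite lerD // ler_wpM2l.
Qed.

End moments.

End simple_compensated_integral_theory.

(** * Passing to the limit *)

Section square_approximation.
Import HBSimple HBNNSimple.
Context d' (S : measurableType d') (R : realType) (mu : {measure set S -> \bar R}).

(** The integral is a finite sum of squared nonzero values times measures of level sets, so no level
    set of a nonzero value can have infinite measure, and there are finitely many of them. *)
Lemma sfun_support_lty (s : {sfun S >-> R}) :
  \int[mu]_x (s x ^+ 2)%:E < +oo -> mu [set x | s x != 0%R] < +oo.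
Proof.
rewrite (@integral_comp_sfun _ _ _ s mu (fun y => y ^+ 2)%R) ?expr0n //; last first.
  by move=> y; exact: sqr_ge0.
move=> sumoo.
have loo i : mu (@level_set _ _ _ s i) < +oo.
  rewrite ltey; apply/eqP => muoo; move: sumoo.
  rewrite (bigD1 i) //= muoo gt0_muley ?lte_fin ?exprn_even_gt0 ?level_value_neq0 //.
  rewrite addye // gt_eqF // (lt_le_trans ltNy0) // sume_ge0 // => j _.
  by rewrite mule_ge0 // lee_fin sqr_ge0.
pose h (y : R) : R := (y != 0%R)%:R.
have -> : mu [set x | s x != 0%R] = \int[mu]_x (h (s x))%:E.
  rewrite -[X in mu X]setIT -integral_indic //; last exact: measurable_nonzero_set.
  apply: eq_integral => x _; rewrite indicE /h; congr ((nat_of_bool _)%:R%:E).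
  by apply/idP/idP; rewrite in_setE.
rewrite integral_comp_sfun ?/h ?eqxx //.
by apply/lte_sum_pinfty => i _; rewrite lte_mul_pinfty // lee_fin.
Qed.

(** The positive and negative parts of [f] are approximated from below and the approximations
    subtracted. At each point one of the two parts vanishes, hence the pointwise domination by [f],
    which bounds absolute moments of all orders at once. *)
Lemma sfun_dense_L2 (f : S -> R) :
  measurable_fun setT f -> \int[mu]_x (f x ^+ 2)%:E < +oo ->
  exists t : nat -> {sfun S >-> R},
    [/\ forall n x, (`|t n x| <= `|f x|)%R,
        forall n, mu [set x | t n x != 0%R] < +oo &
        \int[mu]_x ((t n x - f x) ^+ 2)%:E @[n --> \oo] --> 0].
Proof.
move=> mf f2.
pose fp x := (Num.max (f x) 0)%R; pose fn x := (Num.max (- f x) 0)%R.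
have mfp : measurable_fun setT (EFin \o fp).
  by apply/measurable_EFinP; exact: measurable_maxr.
have mfn : measurable_fun setT (EFin \o fn).
  by apply/measurable_EFinP; apply: measurable_maxr => //; exact: measurableT_comp.
have fp0 x : setT x -> 0 <= (EFin \o fp) x by move=> _; rewrite lee_fin le_max lexx orbT.
have fn0 x : setT x -> 0 <= (EFin \o fn) x by move=> _; rewrite lee_fin le_max lexx orbT.
pose gp := nnsfun_approx measurableT mfp; pose gn := nnsfun_approx measurableT mfn.
have gp_le n x : (gp n x <= fp x)%R.
  by rewrite -lee_fin /gp nnsfun_approxE; exact: le_approx.
have gn_le n x : (gn n x <= fn x)%R.
  by rewrite -lee_fin /gn nnsfun_approxE; exact: le_approx.
have gp_cvg x : gp n x @[n --> \oo] --> fp x.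
  have /= := cvg_approx fp0 (I : setT x) (ltry _).
  by apply: cvg_trans; under eq_fun do rewrite /gp nnsfun_approxE.
have gn_cvg x : gn n x @[n --> \oo] --> fn x.
  have /= := cvg_approx fn0 (I : setT x) (ltry _).
  by apply: cvg_trans; under eq_fun do rewrite /gn nnsfun_approxE.
pose t n : {sfun S >-> R} := ((gp n : {sfun S >-> R}) - (gn n : {sfun S >-> R}))%R.
have tE n x : t n x = (gp n x - gn n x)%R by [].
have fE x : f x = (fp x - fn x)%R.
  rewrite /fp /fn; have [n0|/ltW n0] := leP 0%R (f x).
    by rewrite max_r ?oppr_le0 // subr0.
  by rewrite max_l ?oppr_ge0 // sub0r opprK.
have t_le n x : (`|t n x| <= `|f x|)%R.
  have gp0 : (0 <= gp n x)%R by [].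
  have gn0 : (0 <= gn n x)%R by [].
  have := gp_le n x; have := gn_le n x; rewrite tE /fp /fn.
  have [n0|/ltW n0] := leP 0%R (f x).
    rewrite max_r ?oppr_le0 // => h1 h2; rewrite (ger0_norm n0).
    by rewrite ler_norml; lra.
  rewrite max_l ?oppr_ge0 // => h1 h2; rewrite (ler0_norm n0).
  by rewrite ler_norml; lra.
have mf2 : measurable_fun setT (fun x => (f x ^+ 2)%:E).
  by apply/measurable_EFinP; exact: measurable_funX.
exists t; split => //.
  move=> n; apply: sfun_support_lty; apply: le_lt_trans f2; apply: ge0_le_integral => //.
  - by move=> x _; rewrite lee_fin sqr_ge0.
  - by apply/measurable_EFinP; exact: measurable_funX.
  - move=> x _; rewrite lee_fin -[leLHS]real_normK ?num_real //.
    by rewrite -[leRHS]real_normK ?num_real // lerXn2r ?nnegrE.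
have cvg0 x : ((t n x - f x) ^+ 2)%:E @[n --> \oo] --> 0.
  apply/fine_cvgP; split; first exact: nearW.
  have : ((gp n x - gn n x - f x) ^+ 2)%R @[n --> \oo] --> ((fp x - fn x - f x) ^+ 2)%R.
    have h : (gp n x - gn n x - f x)%R @[n --> \oo] --> (fp x - fn x - f x)%R.
      by apply: cvgB; [exact: cvgB|exact: cvg_cst].
    exact: cvgM.
  by rewrite -fE subrr expr0n.
(* The dominating function is the square of [2 * f], since the distance from [t n] to [f] is at most
   twice the absolute value of [f]. *)
have [] := @dominated_convergence _ _ _ mu setT measurableT
  (fun n x => ((t n x - f x) ^+ 2)%:E) (cst 0) (fun x => 4%:E * (f x ^+ 2)%:E).
- move=> n; apply/measurable_EFinP; apply: measurable_funX; exact: measurable_funB.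
- exact: measurable_cst.
- exact: aeW.
- apply: integrableZl => //; apply/integrableP; split => //.
  by under eq_integral do rewrite gee0_abs ?lee_fin ?sqr_ge0 //.
- apply: aeW => x n _; rewrite gee0_abs ?lee_fin ?sqr_ge0 //.
  rewrite (_ : 4 = 2 ^+ 2)%R; last by rewrite -natrX.
  rewrite -[X in (_ <= _ * X)%R]real_normK ?num_real // -exprMn.
  rewrite -[leLHS]real_normK ?num_real //.
  rewrite lerXn2r ?nnegrE ?mulr_ge0 //.
  by rewrite (le_trans (ler_normB _ _)) // mulr2n mulrDl mul1r lerD.
by move=> _ _; rewrite integral0.
Qed.

End square_approximation.

Section moment_limit.
Context d (T : measurableType d) (R : realType) (P : probability T R).

(** On [[0, K]] the [p]-th power is Lipschitz with constant [p%:R * K ^+ p.-1]: in the factorisation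
    of a difference of [p]-th powers each of the [p] terms is at most [K ^+ p.-1]. If the truncation
    is at most the absolute value of [y], the first term on the right suffices. *)
Lemma truncated_expr_le (x y K : R) p : (0 <= K)%R ->
  (Num.min `|x| K ^+ p <= `|y| ^+ p + p%:R * K ^+ p.-1 * `|y - x|)%R.
Proof.
move=> K0; set a := Num.min _ _.
have aK : (a <= K)%R by rewrite ge_min lexx orbT.
have ax : (a <= `|x|)%R by rewrite ge_min lexx.
have a0 : (0 <= a)%R by rewrite le_min normr_ge0.
have L0 : (0 <= p%:R * K ^+ p.-1)%R by rewrite mulr_ge0 // exprn_ge0.
have [ay|ya] := leP a `|y|%R.
  have ap : (a ^+ p <= `|y| ^+ p)%R by rewrite lerXn2r ?nnegrE.
  by rewrite (le_trans ap) // lerDl mulr_ge0.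
rewrite -lerBlDl subrXX mulrC; apply: ler_pM.
- by apply: sumr_ge0 => i _; rewrite mulr_ge0 ?exprn_ge0.
- by rewrite subr_ge0 ltW.
- apply: (@le_trans _ _ (\sum_(i < p) K ^+ p.-1)%R); last first.
    by rewrite sumr_const card_ord mulr_natl.
  apply: ler_sum => i _.
  have ip : (i <= p.-1)%N by rewrite -ltnS prednK // (leq_ltn_trans _ (ltn_ord i)).
  rewrite -{2}(subnK ip) exprD ?subn1.
  apply: ler_pM; rewrite ?exprn_ge0 // lerXn2r ?nnegrE //.
  exact: le_trans (ltW ya) aK.
apply: le_trans (_ : (`|x| - `|y| <= _)%R); first by rewrite lerB.
by rewrite distrC lerB_dist.
Qed.

(** Truncation at level [K] makes the [p]-th power Lipschitz, so convergence in [L^2] transfers the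
    bound to the truncated moment; monotone convergence in [K] then removes the truncation. *)
Lemma le_moment_of_L2_limit (X : T -> R) (Y : nat -> T -> R) p (c : R) :
  measurable_fun setT X -> (forall n, measurable_fun setT (Y n)) ->
  (forall n, \int[P]_w (`|Y n w| ^+ p)%:E <= c%:E) ->
  \int[P]_w ((Y n w - X w) ^+ 2)%:E @[n --> \oo] --> 0 ->
  \int[P]_w (`|X w| ^+ p)%:E <= c%:E.
Proof.
move=> mX mY Yc YX.
pose Z (K : nat) w := (Num.min `|X w| K%:R ^+ p)%R.
have mZ K : measurable_fun setT (Z K).
  apply: measurable_funX; apply: measurable_minr => //.
  exact: measurableT_comp.
have Z0 K w : (0 <= Z K w)%R by rewrite exprn_ge0 // le_min normr_ge0 ler0n.
have trunc K : \int[P]_w (Z K w)%:E <= c%:E.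
  apply/lee_addgt0Pr => e e0.
  pose L : R := (p%:R * K%:R ^+ p.-1)%R.
  have L0 : (0 <= L)%R by rewrite mulr_ge0 // exprn_ge0.
  (* Chosen so that the final error [2 * L * eps] is at most [e]; adding 1 keeps the denominator
     positive when [L = 0]. *)
  pose eps := (e / (2 * (L + 1)))%R.
  have eps0 : (0 < eps)%R by rewrite divr_gt0 // mulr_gt0 // ltr_pwDr.
  have [n neps] : exists n, \int[P]_w ((Y n w - X w) ^+ 2)%:E < (eps ^+ 2)%:E.
    have /YX [n _ /(_ n (leqnn n))] : nbhs (0 : \bar R) [set x | x < (eps ^+ 2)%:E].
      apply: open_nbhs_nbhs; split; first exact: open_ereal_lt_ereal.
      by rewrite /= lte_fin exprn_gt0.
    by move=> h; exists n.
  have mY2 : measurable_fun setT (fun w => (Y n w - X w) ^+ 2)%R.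
    by apply: measurable_funX; exact: measurable_funB.
  have mYp : measurable_fun setT (fun w => `|Y n w| ^+ p)%R.
    by apply: measurable_funX; exact: measurableT_comp.
  (* The linear error is traded for a quadratic one through [b <= eps + b ^+ 2 / eps], where [b] is
     the distance from [Y n w] to [X w]. *)
  apply: (@le_trans _ _ (\int[P]_w ((`|Y n w| ^+ p)%:E +
      ((L * eps)%:E + (L / eps)%:E * ((Y n w - X w) ^+ 2)%:E)))).
    apply: ge0_le_integral => //.
    - by move=> w _; rewrite lee_fin.
    - exact/measurable_EFinP.
    - apply: emeasurable_funD; first exact/measurable_EFinP.
      by apply: emeasurable_funD => //; apply: measurable_funeM; exact/measurable_EFinP.
    move=> w _; rewrite -EFinM -!EFinD lee_fin.
    apply: le_trans (truncated_expr_le (X w) (Y n w) p (ler0n _ K)) _.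
    rewrite lerD2l -[leLHS]/(L * _)%R -[(L / eps * _)%R]mulrA -mulrDr ler_wpM2l //.
    rewrite -[X in (_ + _ * X)%R]real_normK ?num_real //.
    set b := `|_|%R; have b0 : (0 <= b)%R by exact: normr_ge0.
    rewrite -(ler_pM2l eps0) mulrDr mulVKf ?gt_eqF // -subr_ge0.
    rewrite (_ : _ - _ = (eps - b / 2) ^+ 2 + 3 / 4 * b ^+ 2)%R; last by field.
    by rewrite addr_ge0 ?sqr_ge0 // mulr_ge0 ?sqr_ge0 //; lra.
  rewrite ge0_integralD //; last 3 first.
  - exact/measurable_EFinP.
  - move=> w _; rewrite -EFinM -EFinD lee_fin; apply: addr_ge0; apply: mulr_ge0 => //.
    + exact: ltW.
    + by apply: divr_ge0 => //; exact: ltW.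
    + exact: sqr_ge0.
  - by apply: emeasurable_funD => //; apply: measurable_funeM; exact/measurable_EFinP.
  apply: leeD => //.
  rewrite ge0_integralD //; last 3 first.
  - by move=> w _; rewrite lee_fin mulr_ge0 // ltW.
  - by move=> w _; rewrite -EFinM lee_fin mulr_ge0 ?sqr_ge0 // divr_ge0 // ltW.
  - by apply: measurable_funeM; exact/measurable_EFinP.
  rewrite integral_cst //= probability_setT mule1 ge0_integralZl_EFin //; last 3 first.
  - by move=> w _; rewrite lee_fin sqr_ge0.
  - exact/measurable_EFinP.
  - by rewrite divr_ge0 // ltW.
  apply: (@le_trans _ _ ((L * eps)%:E + (L / eps)%:E * (eps ^+ 2)%:E)).
    apply: leeD => //; apply: lee_wpmul2l; last exact: ltW.
    by rewrite lee_fin; apply: divr_ge0 => //; exact: ltW.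
  rewrite -EFinM -EFinD lee_fin (_ : _ + _ = L * (2 * eps))%R; last first.
    by field; rewrite gt_eqF.
  rewrite /eps (_ : L * (2 * (e / (2 * (L + 1)))) = e * (L / (L + 1)))%R; last first.
    by field; rewrite gt_eqF // ltr_pwDr.
  apply: ler_piMr; first exact: ltW.
  by rewrite ler_pdivrMr ?ltr_pwDr // mul1r lerDl.
have limZ w : limn (fun K => (Z K w)%:E) = (`|X w| ^+ p)%:E.
  apply: lim_near_cst => //; exists (Num.truncn `|X w|).+1 => // K /= XK.
  rewrite /Z min_l // ltW // (lt_le_trans (truncnS_gt _)) //.
  by rewrite ler_nat.
under eq_integral do rewrite -limZ.
rewrite monotone_convergence //; last 3 first.
- by move=> K; exact/measurable_EFinP.
- by move=> K w _; rewrite lee_fin.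
- move=> w _ j K jK; rewrite lee_fin lerXn2r ?nnegrE ?le_min ?normr_ge0 ?ler0n //.
  by rewrite !ge_min lexx /= ler_nat jK orbT.
apply: lime_le; last exact: nearW.
apply: ereal_nondecreasing_is_cvgn => j K jK; apply: ge0_le_integral => //.
- by move=> w _; rewrite lee_fin.
- exact/measurable_EFinP.
- exact/measurable_EFinP.
move=> w _; rewrite lee_fin lerXn2r ?nnegrE ?le_min ?normr_ge0 ?ler0n //.
by rewrite !ge_min lexx /= ler_nat jK orbT.
Qed.

End moment_limit.

Section compensated_integral.
Import HBSimple.
Context d (T : measurableType d) (R : realType) (P : probability T R).
Context d' (S : measurableType d').
Context (mu : {measure set S -> \bar R}) (N : R.-ker T ~> S).
Hypothesis hN : poisson_random_measure P mu N.

Lemma integral_sqrD_le d1 (U : measurableType d1) (m : {measure set U -> \bar R})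
    (f g : U -> R) : measurable_fun setT f -> measurable_fun setT g ->
  \int[m]_x ((f x + g x) ^+ 2)%:E <=
    2%:E * \int[m]_x (f x ^+ 2)%:E + 2%:E * \int[m]_x (g x ^+ 2)%:E.
Proof.
move=> mf mg.
have m2 (h : U -> R) : measurable_fun setT h -> measurable_fun setT (fun x => (h x ^+ 2)%:E).
  by move=> mh; apply/measurable_EFinP; exact: measurable_funX.
have h0 (h : U -> R) x : setT x -> 0 <= (h x ^+ 2)%:E by rewrite lee_fin sqr_ge0.
rewrite -!ge0_integralZl_EFin //; try exact: m2; try exact: h0.
rewrite -ge0_integralD //; last 4 first.
- by move=> x _; rewrite -EFinM lee_fin mulr_ge0 ?sqr_ge0.
- by apply: measurable_funeM; exact: m2.
- by move=> x _; rewrite -EFinM lee_fin mulr_ge0 ?sqr_ge0.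
- by apply: measurable_funeM; exact: m2.
apply: ge0_le_integral => //.
- by move=> x _; rewrite lee_fin sqr_ge0.
- by apply: m2; exact: measurable_funD.
- by apply: emeasurable_funD; apply: measurable_funeM; exact: m2.
move=> x _; rewrite -!EFinM -EFinD lee_fin -subr_ge0.
by rewrite (_ : _ - _ = (f x - g x) ^+ 2)%R ?sqr_ge0 //; ring.
Qed.

Lemma compensated_integral_moment_le (f : S -> R) (X : {RV P >-> R}) p (beta : R) :
  measurable_fun setT f -> (2 <= p)%N -> ~~ odd p -> (0 < beta)%R ->
  \int[mu]_x (`|f x| ^+ 2)%:E <= (beta ^+ 2)%:E ->
  \int[mu]_x (`|f x| ^+ p)%:E <= (beta ^+ p)%:E ->
  is_compensated_integral mu N f X ->
  \int[P]_w (`|X w| ^+ p)%:E <= ((card_partitions_ge2 p)%:R * beta ^+ p)%:E.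
Proof.
move=> mf p2 evp beta0 f2 fp [s [soo sf sX]].
have f2oo : \int[mu]_x (f x ^+ 2)%:E < +oo.
  apply: le_lt_trans (ltry (beta ^+ 2)%R); apply: le_trans f2.
  rewrite le_eqVlt; apply/orP; left; apply/eqP.
  by apply: eq_integral => x _; rewrite real_normK ?num_real.
(* Nothing bounds the [p]-th moments of [s n]; those of [t n] are bounded by the
   ones of [f], and the isometry gives the same limit. *)
have [t [t_le too tf]] := sfun_dense_L2 mf f2oo.
have mX : measurable_fun setT X by [].
pose I := simple_compensated_integral mu N.
have mI u : measurable_fun setT (I u) by exact: measurable_simple_compensated_integral.
apply: (@le_moment_of_L2_limit _ _ _ P X (fun n => I (t n)) p _ mX (fun n => mI (t n))).
- move=> n; apply: simple_compensated_integral_moment_le => //.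
  + apply: le_trans f2; apply: ge0_le_integral => //.
    * by apply/measurable_EFinP; apply: measurable_funX; exact: measurableT_comp.
    * by apply/measurable_EFinP; apply: measurable_funX; exact: measurableT_comp.
    * by move=> x _; rewrite lee_fin lerXn2r ?nnegrE.
  + apply: le_trans fp; apply: ge0_le_integral => //.
    * by apply/measurable_EFinP; apply: measurable_funX; exact: measurableT_comp.
    * by apply/measurable_EFinP; apply: measurable_funX; exact: measurableT_comp.
    * by move=> x _; rewrite lee_fin lerXn2r ?nnegrE.
(* The error splits as [I (t n - s n)] plus [I (s n) - X]. The isometry turns the first part into
   the squared distance of [t n] and [s n], which is compared through [f]. *)
have bound n : \int[P]_w ((I (t n) w - X w) ^+ 2)%:E <=
   2%:E * (2%:E * \int[mu]_x ((t n x - f x) ^+ 2)%:E +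
           2%:E * \int[mu]_x ((s n x - f x) ^+ 2)%:E)
   + 2%:E * 'E_P[fun w => ((I (s n) w - X w) ^+ 2)%R].
  have [tsoo Its] := simple_compensated_integralB hN (too n) (soo n).
  have -> : \int[P]_w ((I (t n) w - X w) ^+ 2)%:E =
      \int[P]_w ((I (t n - s n)%R w + (I (s n) w - X w)) ^+ 2)%:E.
    apply: ae_eq_integral => //.
    + apply/measurable_EFinP; apply: measurable_funX; exact: measurable_funB.
    + apply/measurable_EFinP; apply: measurable_funX; apply: measurable_funD => //.
      exact: measurable_funB.
    + by move: Its; apply: filterS => w IE _; rewrite /I IE addrA subrK.
  apply: le_trans (integral_sqrD_le P (mI _) (measurable_funB (mI _) mX)) _.
  rewrite unlock; apply: leeD => //; apply: lee_wpmul2l => //.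
  rewrite simple_compensated_integral_isometry //.
  under eq_integral => x _.
    rewrite (_ : (t n - s n)%R x = (t n x - f x) + - (s n x - f x))%R; last first.
      by rewrite -[LHS]/(t n x - s n x)%R; ring.
    over.
  apply: le_trans (integral_sqrD_le mu (f := fun x => (t n x - f x)%R)
     (g := fun x => (- (s n x - f x))%R) _ _) _.
  - exact: measurable_funB.
  - by apply: measurableT_comp => //; exact: measurable_funB.
  by under [X in _ + _ * X <= _]eq_integral do rewrite sqrrN.
apply: (@squeeze_cvge _ _ _ _ (cst 0) _ (fun n =>
   2%:E * (2%:E * \int[mu]_x ((t n x - f x) ^+ 2)%:E +
           2%:E * \int[mu]_x ((s n x - f x) ^+ 2)%:E)
   + 2%:E * 'E_P[fun w => ((I (s n) w - X w) ^+ 2)%R])).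
- apply: nearW => n; rewrite bound andbT; apply: integral_ge0 => w _.
  by rewrite lee_fin sqr_ge0.
- exact: cvg_cst.
rewrite (_ : 0 = 2%:E * (2%:E * 0 + 2%:E * 0) + 2%:E * 0); last first.
  by rewrite !mule0 !adde0 mule0.
apply: cvgeD; first by rewrite !mule0.
  apply: cvgeZl => //; apply: cvgeD; first by rewrite !mule0.
    exact: cvgeZl.
  exact: cvgeZl.
exact: cvgeZl.
Qed.

End compensated_integral.

(** * Integrals against the Levy basis *)

Section sigma_finite_alias.
Context d (T : measurableType d) (R : realType) (mu : {measure set T -> \bar R}).
Hypothesis sf : sigma_finite setT mu.

(* A constant to which sigma-finiteness, only a hypothesis on [mu], can be
   attached as a canonical structure. *)
Definition sigma_finite_alias : set T -> \bar R := mu.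
HB.instance Definition _ := Measure.on sigma_finite_alias.
HB.instance Definition _ := Measure_isSigmaFinite.Build _ _ _ sigma_finite_alias sf.
Definition sigma_finite_pack : {sigma_finite_measure set T -> \bar R} := sigma_finite_alias.

End sigma_finite_alias.

Section levy_intensity.
Context (R : realType).

Lemma measurable_nonzero_val : measurable_fun setT (@nonzero_val R : R0 R -> R).
Proof. by move=> _ B mB; rewrite setTI; exists B => //; rewrite setTI. Qed.

Lemma measurable_abs_nonzero_val q :
  measurable_fun setT (fun z : R0 R => `|nonzero_val z| ^+ q)%R.
Proof.
apply: measurable_funX.
exact: measurableT_comp measurable_nonzero_val.
Qed.

Lemma moment_ge0 (nu : {measure set (R0 R) -> \bar R}) q : 0 <= moment nu q.
Proof. by apply: integral_ge0 => z _; rewrite lee_fin exprn_ge0. Qed.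

(** The sets where the squared modulus is at least [1 / n.+1] cover the space because the origin is
    excluded, and have finite measure by Chebyshev's inequality. *)
Lemma sigma_finite_of_moment2 (nu : {measure set (R0 R) -> \bar R}) :
  moment nu 2 < +oo -> sigma_finite setT nu.
Proof.
move=> nu2; pose F n : set (R0 R) := [set z | (n.+1%:R^-1 <= `|nonzero_val z| ^+ 2)%R].
have mF n : measurable (F n).
  rewrite (_ : F n = (fun z : R0 R => `|nonzero_val z| ^+ 2)%R @^-1`
      [set` Interval (BLeft (n.+1%:R^-1 : R)%R) (BInfty R false)]).
    rewrite -[X in measurable X]setTI.
    by apply: measurable_abs_nonzero_val => //; exact: measurable_itv.
  by apply/seteqP; split => z; rewrite /F /= in_itv /= andbT.
exists F.
  apply/esym; rewrite -subTset => z _.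
  have z0 : (0 < `|nonzero_val z| ^+ 2)%R by rewrite exprn_gt0 // normr_gt0; exact: (svalP z).
  exists (Num.truncn (`|nonzero_val z| ^+ 2)^-1) => //.
  rewrite /F /= -[leRHS]invrK lef_pV2 ?posrE ?invr_gt0 //.
  exact: ltW (truncnS_gt _).
move=> n; split => //.
have n0 : (0 < n.+1%:R^-1 :> R)%R by rewrite invr_gt0.
have : n.+1%:R^-1%:E * nu (F n) <= moment nu 2.
  rewrite -[X in nu X]setIT -integral_indic // -ge0_integralZl_EFin //;
    last by apply/measurable_EFinP; exact: measurable_indic.
  apply: ge0_le_integral => //.
  - by apply: measurable_funeM; apply/measurable_EFinP; exact: measurable_indic.
  - exact/measurable_EFinP/measurable_abs_nonzero_val.
  move=> z _; rewrite -EFinM lee_fin indicE; have [|_] := boolP (z \in F n).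
    by rewrite in_setE mulr1.
  by rewrite mulr0.
move=> /le_lt_trans/(_ nu2); rewrite ltNge => noo.
rewrite ltey; apply: contra noo => /eqP ->.
by rewrite gt0_muley ?lte_fin.
Qed.

Lemma integral_intensity (nu : {measure set (R0 R) -> \bar R}) (phi : R -> R) q :
  moment nu 2 < +oo -> measurable_fun setT (phi : measurableTypeR R -> R) ->
  \int[intensity nu]_u (`|phi u.1 * nonzero_val u.2| ^+ q)%:E =
  moment nu q * \int[lebesgue_measure]_x (`|phi x| ^+ q)%:E.
Proof.
move=> /sigma_finite_of_moment2 sf mphi.
pose nu' := sigma_finite_pack sf.
have mphiq : measurable_fun setT (fun x : measurableTypeR R => (`|phi x| ^+ q)%:E).
  by apply/measurable_EFinP; apply: measurable_funX; exact: measurableT_comp.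
(* Tonelli's theorem requires a sigma-finite second factor, hence [nu']; the two product measures
   coincide because they agree on rectangles. *)
transitivity (\int[lebesgue_measure \x nu']_u (`|phi u.1 * nonzero_val u.2| ^+ q)%:E).
  apply: eq_measure_integral => /= A mA _; apply/esym.
  by apply: product_measure_unique => //= B C mB mC; rewrite product_measure2E.
rewrite fubini_tonelli2 //; last first.
  apply/measurable_EFinP; apply: measurable_funX; apply: measurableT_comp => //.
  apply: measurable_funM.
    exact: (measurableT_comp mphi).
  exact: (measurableT_comp measurable_nonzero_val).
transitivity (\int[nu]_z ((`|nonzero_val z| ^+ q)%:E *
    \int[lebesgue_measure]_x (`|phi x| ^+ q)%:E)).
  apply: eq_integral => z _; rewrite /fubini_G /=.
  under eq_integral do rewrite normrM exprMn mulrC EFinM.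
  by rewrite ge0_integralZl_EFin // => x _; rewrite lee_fin exprn_ge0.
rewrite ge0_integralZr //.
- exact/measurable_EFinP/measurable_abs_nonzero_val.
- by apply: integral_ge0 => x _; rewrite lee_fin exprn_ge0.
Qed.

Context d (T : measurableType d) (P : probability T R).
Context (nu : {measure set (R0 R) -> \bar R}) (hm2 : moment nu 2 < +oo).
Context (N : R.-ker T ~> (measurableTypeR R * R0 R)%type).
Hypothesis hN : poisson_random_measure P (intensity nu) N.
Context (p : nat) (hp2 : (2 <= p)%N) (hp : ~~ odd p).

Lemma levy_integral_moment_le (phi : R -> R) (X : {RV P >-> R}) :
  measurable_fun setT (phi : measurableTypeR R -> R) ->
  \int[lebesgue_measure]_x (`|phi x| ^+ 2)%:E < +oo ->
  is_levy_integral nu N phi X ->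
  'E_P[fun w => (`|X w| ^+ p)%R] <=
    (card_partitions_ge2 p)%:R%:E *
    ((moment nu 2 * \int[lebesgue_measure]_x (`|phi x| ^+ 2)%:E) ^+ (p./2) +
     moment nu p * \int[lebesgue_measure]_x (`|phi x| ^+ p)%:E).
Proof.
move=> mphi phi2 HX; rewrite unlock.
have int_ge0 q : 0 <= \int[lebesgue_measure]_x (`|phi x| ^+ q)%:E.
  by apply: integral_ge0 => x _; rewrite lee_fin exprn_ge0.
set a := moment nu 2 * _; set b := moment nu p * _.
have a0 : 0 <= a by rewrite mule_ge0 ?moment_ge0.
have b0 : 0 <= b by rewrite mule_ge0 ?moment_ge0.
have aoo : a < +oo by rewrite lte_mul_pinfty ?moment_ge0 // ge0_fin_numE ?moment_ge0.
have a_fin : a \is a fin_num by rewrite ge0_fin_numE.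
have c0 : (0 < (card_partitions_ge2 p)%:R :> R)%R by rewrite ltr0n card_partitions_ge2_gt0.
have p0 : (0 < p)%N by exact: leq_trans hp2.
(* If [b] is infinite then so is the right-hand side, the partition count being positive. *)
have [boo|] := eqVneq b +oo.
  rewrite boo addey ?gt0_muley ?lte_fin ?leey //.
  by rewrite gt_eqF // (lt_le_trans ltNy0) // expe_ge0.
rewrite -ltey => boo.
have b_fin : b \is a fin_num by rewrite ge0_fin_numE.
apply/lee_addgt0Pr => e e0.
(* Multiplied by the partition count, this slack becomes [e]; it also keeps [beta] positive when [a]
   and [b] both vanish. *)
pose e' := (e / (card_partitions_ge2 p)%:R)%R.
have e'0 : (0 < e')%R by rewrite divr_gt0.
pose c := (fine a ^+ p./2 + fine b + e')%R.
have cc0 : (0 < c)%R by rewrite ltr_wpDl // addr_ge0 ?exprn_ge0 ?fine_ge0.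
pose beta := (c `^ (p%:R^-1))%R.
have beta0 : (0 < beta)%R by rewrite powR_gt0.
have betap : (beta ^+ p = c)%R.
  by rewrite -powR_mulrn ?powR_ge0 // -powRrM mulVf ?powRr1 ?ltW // pnatr_eq0 -lt0n.
have p2E : (p./2 * 2 = p)%N by rewrite muln2 even_halfK.
have beta2 : (fine a <= beta ^+ 2)%R.
  rewrite -(@ler_pXn2r _ p./2) ?nnegrE ?fine_ge0 ?exprn_ge0 ?half_gt0 //; last exact: ltW.
  rewrite -exprM mulnC p2E betap /c -addrA lerDl addr_ge0 ?fine_ge0 //.
  exact: ltW.
apply: (@le_trans _ _ ((card_partitions_ge2 p)%:R * beta ^+ p)%:E).
  apply: (compensated_integral_moment_le hN _ hp2 hp beta0 _ _ HX).
  - apply: measurable_funM; first exact: (measurableT_comp mphi).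
    exact: (measurableT_comp measurable_nonzero_val).
  - by rewrite integral_intensity // -/a -(fineK a_fin) lee_fin.
  - rewrite integral_intensity // -/b -(fineK b_fin) lee_fin betap /c addrAC.
    by rewrite lerDr addr_ge0 ?exprn_ge0 ?fine_ge0 // ltW.
rewrite betap -(fineK a_fin) -(fineK b_fin) -EFin_expe -!EFinD lee_fin.
by rewrite /c mulrDr lerD2l /e' mulrC divfK // gt_eqF.
Qed.

End levy_intensity.

Theorem lemma3p1 (R : realType) (d : measure_display) (T : measurableType d)
    (P : probability T R) (hP : measure_is_complete P)
    (nu : {measure set (R0 R) -> \bar R}) (hm2 : moment nu 2 < +oo)
    (N : R.-ker T ~> (measurableTypeR R * R0 R)%type)
    (hN : poisson_random_measure P (intensity nu) N)
    (p : nat) (hp2 : (2 <= p)%N) (hp : ~~ odd p) (hmp : moment nu p < +oo) :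
  (forall phi : R -> R, phi \in Lfun lebesgue_measure 2%:E ->
    forall Lphi : {RV P >-> R}, is_levy_integral nu N phi Lphi ->
      'E_P[fun w => (`|Lphi w| ^+ p)%R] <=
      (card_partitions_ge2 p)%:R%:E *
        ((moment nu 2 *
            \int[lebesgue_measure]_x (`|phi x| ^+ 2)%:E) ^+ (p./2) +
         moment nu p * \int[lebesgue_measure]_x (`|phi x| ^+ p)%:E)) /\
  (forall A : set (measurableTypeR R), measurable A ->
    bounded_set (A : set R^o) ->
    forall LA : {RV P >-> R}, is_levy_integral nu N \1_A LA ->
      'E_P[fun w => (`|LA w| ^+ p)%R] <=
      (card_partitions_ge2 p)%:R%:E *
        ((moment nu 2 * lebesgue_measure A) ^+ (p./2) +
         moment nu p * lebesgue_measure A)).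
Proof.
split=> [phi phi2 Lphi HL|A mA Abnd LA HL].
  apply: (levy_integral_moment_le hm2 hN hp2 hp) => //.
    by move: phi2; rewrite inE => /andP[mphi _]; rewrite inE /= in mphi.
  have /integrableP[_] := Lfun2_integrable_sqr phi2.
  apply: le_lt_trans; rewrite le_eqVlt; apply/orP; left; apply/eqP.
  by apply: eq_integral => x _; rewrite /= normrX.
(* Positivity of [q] matters outside [A], where [0 ^+ 0] would be 1. *)
have indicX q : (0 < q)%N -> \int[lebesgue_measure]_x (`|\1_A x| ^+ q)%:E =
    lebesgue_measure A :> \bar R.
  move=> q0; rewrite -[A in RHS]setIT -integral_indic //.
  apply: eq_integral => x _; rewrite indicE; case: (x \in A) => /=.
    by rewrite normr1 expr1n.
  by rewrite normr0 expr0n eqn0Ngt q0.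
have Aoo : lebesgue_measure A < +oo.
  (* Boundedness provides a bound by every number strictly above [M], hence the choice [M + 1]. *)
  have [M [_ /(_ (M + 1)%R) AM]] := Abnd.
  pose J : interval R := Interval (BLeft (- (M + 1))%R) (BRight (M + 1)%R).
  apply: (@le_lt_trans _ _ (lebesgue_measure [set` J])).
    apply: le_measure; [by rewrite inE|by rewrite inE; exact: measurable_itv|].
    have M1 : (M < M + 1)%R by rewrite ltrDl.
    by move=> x /(AM M1); rewrite /= in_itv /= ler_norml.
  by rewrite lebesgue_measure_itv /=; case: ifP => _; rewrite ?ltry // -EFinB ltry.
have := @levy_integral_moment_le _ _ _ P _ hm2 _ hN _ hp2 hp \1_A LA.
rewrite !indicX ?(leq_trans _ hp2) //; apply => //.
Qed.
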